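(* Let $U\subset\mathbb{R}^2$ be open and let $X:U\rightarrow \mathbb{R}^4$ be a (smooth) parametrisation of a regular surface $N=X(U)$. Let $p=X(u_0)\in N$, let ${\bf v}\in T_pN$ be a unit vector, and let $\pi_{\bf v}$ be the orthogonal projection of $\mathbb{R}^4$ along ${\bf v}$ onto ${\bf v}^{\perp}\cong\mathbb{R}^3$, restricted to $N$. Let $\Delta_e$ be the curvature ellipse of $N$ at $p$ and let $\Delta_p$ be the curvature parabola of $\pi_{\bf v}(N)$ (parametrised by $\pi_{\bf v}\circ X$) at $\pi_{\bf v}(p)$. The following hold: (i) $\Delta_e$ is a (non-degenerate) ellipse with $p$ lying inside it if and only if $\Delta_p$ is a (non-degenerate) parabola with $\pi_{\bf v}(p)$ lying inside it. (ii) $\Delta_e$ is an ellipse with $p$ lying outside it, or a segment whose line does not contain $p$, if and only if $\Delta_p$ is a parabola with $\pi_{\bf v}(p)$ lying outside it (this being the case when ${\bf v}$ is not asymptotic) or a half-line whose line does not contain $\pi_{\bf v}(p)$ (this being the case when ${\bf v}$ is asymptotic). (iii) $\Delta_e$ is an ellipse with $p$ lying on it if and only if $\Delta_p$ is a parabola with $\pi_{\bf v}(p)$ lying on it (this being the case when ${\bf v}$ is not asymptotic) or a line which does not contain $\pi_{\bf v}(p)$ (this being the case when ${\bf v}$ is asymptotic). (iv) $\Delta_e$ is a segment whose line contains $p$, or a point different from $p$, if and only if $\Delta_p$ is a line which contains $\pi_{\bf v}(p)$, a half-line whose line contains $\pi_{\bf v}(p)$, or a point different from $\pi_{\bf v}(p)$.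 (v) $\Delta_e$ is the point $p$ if and only if $\Delta_p$ is the point $\pi_{\bf v}(p)$.
   Context: Curvature ellipse. For a regular surface $N\subset\mathbb{R}^4$ with local parametrisation $X$ and $p\in N$, let $\{e_1,e_2\}$ be an orthonormal basis of $T_pN$ and $\{e_3,e_4\}$ an orthonormal basis of the normal plane $N_pN$. The second fundamental form is the quadratic map $II_p:T_pN\to N_pN$, $II_p(w_1e_1+w_2e_2)=\sum_{i=1}^2(l_iw_1^2+2m_iw_1w_2+n_iw_2^2)e_{i+2}$, where, in a parametrisation with $X_x=e_1$, $X_y=e_2$ at $p$, $l_i=\langle X_{xx},e_{i+2}\rangle$, $m_i=\langle X_{xy},e_{i+2}\rangle$, $n_i=\langle X_{yy},e_{i+2}\rangle$ at $p$. The curvature ellipse of $N$ at $p$ is the image in $N_pN$ of $\eta(\theta)=II_p(\cos\theta\, e_1+\sin\theta\, e_2)$, $\theta\in[0,2\pi]$; it is an ellipse, possibly degenerate to a segment or a point. The point $p$ is identified with the origin of $N_pN$. A tangent direction $\theta$ at $p$ is asymptotic if $\eta(\theta)$ and $\frac{d\eta}{d\theta}(\theta)$ are linearly dependent in $N_pN$. Projection. $\pi_{\bf v}(z)=z-\langle z,{\bf v}\rangle{\bf v}$. Since ${\bf v}\in T_pN$, the map $\pi_{\bf v}\circ X$ has corank $1$ at $u_0$. Curvature parabola. Let $M\subset\mathbb{R}^3$ be the image of a smooth map $g:\tilde M\to\mathbb{R}^3$ from a regular surface $\tilde M$, with $g$ of corank $1$ at $q\in\tilde M$ and $g(q)=m$.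 Let $T_mM=\mathrm{im}(dg_q)$ (a line), and let $N_mM$ be its orthogonal complement in $T_m\mathbb{R}^3$ (the normal plane), with orthogonal projection $\perp:T_m\mathbb{R}^3\to N_mM$. The first fundamental form on $T_q\tilde M$ is $I(Y,Z)=\langle dg_q(Y),dg_q(Z)\rangle$. The second fundamental form is the symmetric bilinear map $II:T_q\tilde M\times T_q\tilde M\to N_mM$ given, in local coordinates $(x,y)$ of $\tilde M$ with corresponding local parametrisation $f$ of $M$, by $II(\partial_x,\partial_x)=f_{xx}^\perp$, $II(\partial_x,\partial_y)=f_{xy}^\perp$, $II(\partial_y,\partial_y)=f_{yy}^\perp$ at $q$. Let $C_q\subset T_q\tilde M$ be the set of vectors $Y$ with $I(Y,Y)=1$. The curvature parabola of $M$ at $m$ is the set $\{II(Y,Y): Y\in C_q\}\subset N_mM$; it is a parabola, possibly degenerate to a half-line, a line or a point. The point $m$ is identified with the origin of $N_mM$. Here $g=\pi_{\bf v}\circ X$, $q=u_0$ and $m=\pi_{\bf v}(p)$. ''Ellipse'' and ''parabola'' in the claim mean non-degenerate ones. ''Inside'' an ellipse means in the bounded component of its complement in the plane; ''inside'' a parabola means in the convex component of its complement; ''outside'' means neither inside nor on the curve. The ''line'' of a segment or half-line is the line containing it. *)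

(* Defs.v *)
From HB Require Import structures.
From mathcomp Require Import all_boot all_order all_algebra.
From mathcomp Require Import all_classical all_reals all_analysis.
Set Implicit Arguments.
Unset Strict Implicit.
Unset Printing Implicit Defensive.
Import Order.TTheory GRing.Theory Num.Theory.
Import numFieldNormedType.Exports.
Local Open Scope classical_set_scope.
Local Open Scope ring_scope.

(* Points and vectors are row vectors, so 'J f q
   acts on the right: its rows are the partial derivatives of f at q, and its
   row space is the image of the differential. *)

Definition dot (R : realType) (n : nat) (u w : 'rV[R]_n) : R := (u *m w^T) 0 0.

(* The rows of E are an orthonormal basis of the row space of V. *)
Definition orthonormal_basis_of (R : realType) (m k n : nat)
    (E : 'M[R]_(m, n)) (V : 'M[R]_(k, n)) : Prop :=
  E *m E^T = 1%:M /\ (E == V)%MS.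

(* The orthogonal complement of the row space of V. *)
Definition orth (R : realType) (k n : nat) (V : 'M[R]_(k, n)) : 'M[R]_n :=
  kermx V^T.

Definition proj_along (R : realType) (n : nat) (v z : 'rV[R]_n) : 'rV[R]_n :=
  z - dot z v *: v.

Section Surfaces.
Variables (R : realType) (n : nat).
Implicit Types (f : 'rV[R]_2 -> 'rV[R]_n.+1) (q : 'rV[R]_2).

Definition partial (i : 'I_2) f : 'rV[R]_2 -> 'rV[R]_n.+1 :=
  'D_(delta_mx 0 i : 'rV[R]_2) f.

Definition smooth_on (U : set 'rV[R]_2) f : Prop :=
  forall s : seq 'I_2, {in U, forall u, differentiable (foldr partial f s) u}.

(* Smooth immersion that is a homeomorphism onto its image. *)
Definition regular_parametrisation (U : set 'rV[R]_2) f : Prop :=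
  [/\ smooth_on U f,
      {in U, forall u, row_free ('J f u)} &
      exists2 h : 'rV[R]_n.+1 -> 'rV[R]_2,
        {in U, cancel f h} & {within f @` U, continuous h}].

Definition normal_mx f q : 'M[R]_n.+1 := orth ('J f q).

Definition normal_plane f q : set 'rV[R]_n.+1 :=
  [set z | (z <= normal_mx f q)%MS].

Definition perp f q (z : 'rV[R]_n.+1) : 'rV[R]_n.+1 :=
  z *m proj_mx (normal_mx f q) <<'J f q>>%MS.

Definition first_form f q (Y Z : 'rV[R]_2) : R :=
  dot (Y *m 'J f q) (Z *m 'J f q).

Definition second_form f q (Y Z : 'rV[R]_2) : 'rV[R]_n.+1 :=
  (Y 0 0 * Z 0 0) *: perp f q (partial 0 (partial 0 f) q) +
  (Y 0 0 * Z 0 1 + Y 0 1 * Z 0 0) *: perp f q (partial 1 (partial 0 f) q) +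
  (Y 0 1 * Z 0 1) *: perp f q (partial 1 (partial 1 f) q).

End Surfaces.

Section CurvatureEllipse.
Variable R : realType.
Implicit Types (X : 'rV[R]_2 -> 'rV[R]_4) (u : 'rV[R]_2).

(* If the rows of E lie in the tangent plane of X at u, then this
   reparametrisation takes 0 to X u, and its partial derivatives there are the
   rows of E. *)
Definition adapted_param X u (E : 'M[R]_(2, 4)) (z : 'rV[R]_2) : 'rV[R]_4 :=
  X (u + z *m (E *m pinvmx ('J X u))).

(* The rows of E are e_1, e_2 and the rows of F are e_3, e_4. *)
Definition curvature_map X u (E F : 'M[R]_(2, 4)) (w : 'rV[R]_2) : 'rV[R]_4 :=
  let Y := adapted_param X u E in
  let l i := dot (partial 0 (partial 0 Y) 0) (row i F) in
  let m i := dot (partial 1 (partial 0 Y) 0) (row i F) in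
  let k i := dot (partial 1 (partial 1 Y) 0) (row i F) in
  \sum_(i < 2) (l i * w 0 0 ^+ 2 + 2 * m i * w 0 0 * w 0 1 + k i * w 0 1 ^+ 2)
    *: row i F.

Definition unit_vec (t : R) : 'rV[R]_2 :=
  \row_j (if j == 0 then cos t else sin t).

Definition eta_curve X u (E F : 'M[R]_(2, 4)) (t : R) : 'rV[R]_4 :=
  curvature_map X u E F (unit_vec t).

Definition curvature_ellipse X u (E F : 'M[R]_(2, 4)) : set 'rV[R]_4 :=
  eta_curve X u E F @` `[0, 2 * pi].

(* v = cos t e_1 + sin t e_2 is an asymptotic direction. *)
Definition asymptotic X u (E F : 'M[R]_(2, 4)) (v : 'rV[R]_4) : Prop :=
  exists2 t : R, v = unit_vec t *m E &
    ~~ row_free (col_mx (eta_curve X u E F t) (derive1 (eta_curve X u E F) t)).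

End CurvatureEllipse.

Definition curvature_parabola (R : realType) (g : 'rV[R]_2 -> 'rV[R]_3)
    (q : 'rV[R]_2) : set 'rV[R]_3 :=
  [set second_form g q Y Y | Y in [set Y | first_form g q Y Y = 1]].

(* Non-degenerate conics are given by their standard equations in orthogonal
   axes a, b. *)
Section Shapes.
Variables (R : realType) (n : nat).
Implicit Types (D L P : set 'rV[R]_n.+1) (z : 'rV[R]_n.+1).

Definition is_ellipse D : Prop :=
  exists c a b : 'rV[R]_n.+1, [/\ a != 0, b != 0, dot a b = 0 &
    D = range (fun t : R => c + cos t *: a + sin t *: b)].

Definition is_parabola D : Prop :=
  exists c a b : 'rV[R]_n.+1, [/\ a != 0, b != 0, dot a b = 0 &
    D = range (fun t : R => c + t *: a + t ^+ 2 *: b)].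

Definition is_line D : Prop :=
  exists2 d : 'rV[R]_n.+1, d != 0 &
    exists c, D = range (fun t : R => c + t *: d).

Definition is_halfline D : Prop :=
  exists2 d : 'rV[R]_n.+1, d != 0 &
    exists c, D = (fun t : R => c + t *: d) @` `[0, +oo[.

Definition is_segment D : Prop :=
  exists a b : 'rV[R]_n.+1, a != b /\
    D = (fun t : R => (1 - t) *: a + t *: b) @` `[0, 1].

(* For a segment or a half-line D, the line L is unique. *)
Definition line_contains D z : Prop :=
  exists L, [/\ is_line L, D `<=` L & L z].

Definition line_avoids D z : Prop :=
  exists L, [/\ is_line L, D `<=` L & ~ L z].

(* In the next four definitions, P is the plane of the curve D. *)
Definition inside_ellipse P D z : Prop :=
  (P `\` D) z /\ bounded_set (connected_component (P `\` D) z).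

Definition outside_ellipse P D z : Prop :=
  [/\ P z, ~ D z & ~ inside_ellipse P D z].

Definition inside_parabola P D z : Prop :=
  (P `\` D) z /\
  @convex_set R 'rV[R]_n.+1 (connected_component (P `\` D) z).

Definition outside_parabola P D z : Prop :=
  [/\ P z, ~ D z & ~ inside_parabola P D z].

End Shapes.

(* Main.v *)
(* Let (v, v') be an orthonormal basis of the tangent plane, and let
   A = II(v, v), B = II(v, v') and C = II(v', v').  The curvature ellipse
   consists of the points cos^2 A + 2 cos sin B + sin^2 C.  Projecting along v
   kills v, so the vectors of unit length for the first form of the projection
   are t v +- v', and the curvature parabola consists of the points
   t^2 A + 2 t B + C of the same normal plane.  With
     alpha = det(A, B), beta = det(A, C), gamma = det(B, C),
   the ellipse is non-degenerate iff alpha + gamma <> 0, the parabola is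
   non-degenerate iff alpha <> 0, and v is asymptotic iff alpha = 0.  For both
   curves, the origin is inside, on or outside according to the sign of the
   discriminant beta^2 - 4 alpha gamma of the binary form of asymptotic
   directions; the rest is a case analysis on A, B, C. *)

Require Import Defs.
From HB Require Import structures.
From mathcomp Require Import all_boot all_order all_algebra.
From mathcomp Require Import all_classical all_reals all_analysis.
From mathcomp Require Import ring lra.
Set Implicit Arguments.
Unset Strict Implicit.
Unset Printing Implicit Defensive.
Import Order.TTheory GRing.Theory Num.Theory.
Import numFieldNormedType.Exports.
Local Open Scope classical_set_scope.
Local Open Scope ring_scope.

(** * Symmetry of second derivatives *)

(** The two normal planes can be compared because the first is orthogonal to the tangent vector [v]:
    the projection is isometric on it and carries an orthonormal frame [F] to an orthonormal frame
    [G = F *m B^T] of the other. Both curves then have the same coefficient vectors in the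
    coordinate plane. The discriminant arises as follows. By the double angle formulas the ellipse
    has centre [(A + C) / 2] and conjugate half-diameters [(A - C) / 2] and [B]; Cramer's rule turns
    being inside it into [(gamma - alpha)^2 + beta^2 < (alpha + gamma)^2]. For the parabola the same
    rule gives [beta^2 < (2 alpha) (2 gamma)]. Two obstacles shape the rest. The ellipse is defined
    in an adapted parametrisation and the parabola in the given one, so the second derivative must
    be known as a symmetric bilinear form; equality of mixed partial derivatives is derived from the
    mean value theorem. Inside and outside are defined by connected components, so each conic gets a
    continuous level function that no component can cross, and explicit paths show that an outer
    component is unbounded or not convex. *)

Section SecondDerivatives.
Variables (R : realType) (V : normedModType R).
Implicit Types (f : V -> R) (a u w : V).

Lemma is_derive_line f a u (s : R) : differentiable f (s *: u + a) ->
  is_derive s 1 (fun r : R => f (r *: u + a)) ('D_u f (s *: u + a)).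
Proof.
move=> df.
have E : (fun h : R => h^-1 *:
     (((fun r : R => f (r *: u + a)) \o shift s) (h *: 1) - f (s *: u + a))) =
   (fun h : R => h^-1 *: ((f \o shift (s *: u + a)) (h *: u) - f (s *: u + a))).
  by apply/funext => h /=; rewrite [h *: 1]mulr1 scalerDl addrA.
have := @diff_derivable _ _ _ f _ u df; rewrite /derivable -E => D.
by apply: DeriveDef => //; rewrite /derive E.
Qed.

(** The mean value theorem, applied to [s |-> f (a + s u + h w) - f (a + s u)] on [[0, h]], turns
    the second difference into [h] times an increment of [g], and the differentiability of [g] at
    [a] expands that increment to first order. *)
Lemma second_difference f g a u w (e : R) :
  (\forall x \near a, differentiable f x /\ 'D_u f x = g x) ->
  differentiable g a -> 0 < e ->
  \forall h \near (0 : R)^'+,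
    `| f (h *: w + (h *: u + a)) - f (h *: u + a) - f (h *: w + a) + f a
       - h ^+ 2 * 'D_w g a | <= e * h ^+ 2.
Proof.
move=> df dg e0.
pose M := `|u| + `|w|; have M0 : 0 <= M by rewrite addr_ge0.
(* Two linearisation errors of size at most [e' * h * M], times the factor [h] of the mean value
   theorem, must fit into [e * h ^+ 2]; the [+ 1] keeps the denominator positive when [M = 0]. *)
pose e' := e / (2 * M + 1).
have e'0 : 0 < e' by rewrite divr_gt0 //; lra.
have : \forall k \near 0,
    (differentiable f (k + a) /\ 'D_u f (k + a) = g (k + a)) /\
    `|g (k + a) - g a - 'd g a k| <= e' * `|k|.
  apply: filterI.
    by move: df; rewrite (near_shift 0 a) subr0.
  have /diff_locally/eqaddoP H := dg; have {H} := H _ e'0.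
  apply: filterS => k; rewrite /= !fctE /=.
  by rewrite opprD addrA.
move=> /nbhs_norm0P[d /= d0 Hd].
near=> h.
have h0 : 0 < h by near: h; exact: nbhs_right_gt.
have hd : h * (M + 1) < d.
  rewrite -ltr_pdivlMr; last lra.
  by near: h; apply: nbhs_right_lt; rewrite divr_gt0 //; lra.
have small (s : R) : 0 <= s <= h ->
   `|s *: u + h *: w| <= h * M /\ `|s *: u| <= h * M.
  move=> /andP[s0 sh]; have ? := normr_ge0 u; have ? := normr_ge0 w.
  have nu : `|s *: u| <= h * `|u| by rewrite normrZ ger0_norm // ler_wpM2r.
  have nw : `|h *: w| = h * `|w| by rewrite normrZ gtr0_norm.
  have := ler_normD (s *: u) (h *: w); rewrite /M nw mulrDr => T.
  have ? : 0 <= h * `|w| by rewrite mulr_ge0 // ltW.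
  by split; lra.
have hM : h * M < d by lra.
have dl (s : R) : 0 <= s <= h ->
   (differentiable f (s *: u + (h *: w + a)) /\
    'D_u f (s *: u + (h *: w + a)) = g (s *: u + (h *: w + a))) /\
   (differentiable f (s *: u + a) /\ 'D_u f (s *: u + a) = g (s *: u + a)).
  move=> /small[s1 s2]; rewrite addrA.
  by split; apply: (Hd _ _).1; rewrite /=; apply: le_lt_trans hM.
pose phi (s : R) := f (s *: u + (h *: w + a)) - f (s *: u + a).
pose dphi (s : R) := g (s *: u + (h *: w + a)) - g (s *: u + a).
have Dphi (s : R) : 0 <= s <= h -> is_derive s 1 phi (dphi s).
  by move=> /dl[[d1 e1] [d2 e2]]; rewrite /dphi -e1 -e2; apply: is_deriveB;
  exact: is_derive_line.
have [||xi xi_in] := @MVT R phi dphi 0 h h0.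
- by move=> x; rewrite in_itv /= => /andP[x0 xh]; apply: Dphi; rewrite !ltW.
- apply: derivable_within_continuous => x; rewrite in_itv /= => xh.
  by have [] := Dphi x xh.
rewrite /dphi /phi !scale0r !add0r subr0 => E.
have xi_h : 0 <= xi <= h.
  by move: xi_in; rewrite in_itv /= => /andP[? ?]; rewrite !ltW.
have [s1 s2] := small xi xi_h.
have [_ b1] := Hd (xi *: u + h *: w) (le_lt_trans s1 hM).
have [_ b2] := Hd (xi *: u) (le_lt_trans s2 hM).
have lin : 'd g a (xi *: u + h *: w) = 'd g a (xi *: u) + h * 'D_w g a.
  by rewrite linearD [in X in _ + X]linearZ deriveE.
rewrite (_ : _ - _ = h * (g (xi *: u + (h *: w + a)) - g (xi *: u +
  a) - h * 'D_w g a)); last first.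
  rewrite (_ : h *: w + (h *: u + a) = h *: u + (h *: w + a)); last first.
    by rewrite addrCA.
  by lra.
rewrite normrM gtr0_norm // expr2 mulrCA ler_pM2l //.
(* Since [h * 'D_w g a] is the difference of ['d g a] at the two increments, the expression is a
   difference of two first-order remainders of [g]. *)
rewrite (_ : _ - h * _ =
  (g (xi *: u + h *: w + a) - g a - 'd g a (xi *: u + h *: w))
   - (g (xi *: u + a) - g a - 'd g a (xi *: u))); last first.
  by rewrite lin addrA; lra.
apply: le_trans (ler_normB _ _) _.
have e1 : e' * `|xi *: u + h *: w| <= e' * (h * M) by rewrite ler_pM2l.
have e2 : e' * `|xi *: u| <= e' * (h * M) by rewrite ler_pM2l.
have : e' * (2 * M + 1) = e by rewrite divfK //; lra.
have ? : 0 <= e' * h by rewrite mulr_ge0 // ltW.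
move=> eE; rewrite -eE; nra.
Unshelve. all: by end_near. Qed.

(** The second difference is symmetric in [u] and [w], so [h ^+ 2] times either derivative
    approximates the same quantity up to [e / 2 * h ^+ 2]. *)
Lemma derive_sym f g k a u w :
  (\forall x \near a, [/\ differentiable f x, 'D_u f x = g x & 'D_w f x =
    k x]) ->
  differentiable g a -> differentiable k a -> 'D_w g a = 'D_u k a.
Proof.
move=> df dg dk; apply/eqP; rewrite -subr_eq0 -normr_le0.
apply/ler_addgt0Pl => e e0; rewrite addr0.
have e2 : 0 < e / 2 by rewrite divr_gt0.
pose D (h : R) :=
  f (h *: w + (h *: u + a)) - f (h *: u + a) - f (h *: w + a) + f a.
have D1 : \forall h \near (0 : R)^'+,
    `|D h - h ^+ 2 * 'D_w g a| <= e / 2 * h ^+ 2.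
  by apply: second_difference => //; apply: filterS df => x [].
have D2 : \forall h \near (0 : R)^'+,
    `|D h - h ^+ 2 * 'D_u k a| <= e / 2 * h ^+ 2.
  have df' : \forall x \near a, differentiable f x /\ 'D_w f x = k x.
    by apply: filterS df => x [].
  apply: filterS (second_difference u df' dk e2) => h.
  by rewrite /D addrCA -addrA [_ - f _]addrAC !addrA.
near (0 : R)^'+ => h.
have h0 : 0 < h by near: h; exact: nbhs_right_gt.
have H1 : `|D h - h ^+ 2 * 'D_w g a| <= e / 2 * h ^+ 2 by near: h.
have H2 : `|D h - h ^+ 2 * 'D_u k a| <= e / 2 * h ^+ 2 by near: h.
have hh : 0 < h ^+ 2 by rewrite exprn_gt0.
rewrite -(ler_pM2l hh) -{1}(gtr0_norm hh) -normrM mulrBr.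
move: H1 H2; rewrite !ler_norml => /andP[H1 H2] /andP[H3 H4].
by apply/andP; split; lra.
Unshelve. all: by end_near. Qed.

End SecondDerivatives.

(** * Hessians *)

Section MulmxDerivative.
Variables (R : realType) (V : normedModType R) (m p : nat).
Variable M : 'M[R]_(m, p).
Implicit Types f : V -> 'rV[R]_m.

Lemma differentiable_mulmxr (x : 'rV[R]_m) : differentiable (mulmxr M) x.
Proof.
have -> : mulmxr M = \sum_(i < m) (fun u : 'rV[R]_m => u 0 i *: row i M).
  by apply/funext => u; rewrite fct_sumE /= mulmx_sum_row.
apply: differentiable_sum => i.
exact/differentiableZl/differentiable_coord.
Qed.

Lemma continuous_mulmxr : continuous (mulmxr M : 'rV[R]_m -> 'rV[R]_p).
Proof. move=> x; exact/differentiable_continuous/differentiable_mulmxr. Qed.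

Lemma differentiable_mulmx f x : differentiable f x ->
  differentiable (fun u => f u *m M) x.
Proof.
move=> df; apply: (@differentiable_comp _ _ _ _ f (mulmxr M)) => //.
exact: differentiable_mulmxr.
Qed.

Lemma diff_mulmx f x v : differentiable f x ->
  'd (fun u => f u *m M) x v = 'd f x v *m M.
Proof.
move=> df; rewrite -[fun u => _]/(mulmxr M \o f) diff_comp //=; last first.
  exact: differentiable_mulmxr.
by rewrite diff_lin //; exact: continuous_mulmxr.
Qed.

Lemma derive_mulmx f x v : differentiable f x ->
  'D_v (fun u => f u *m M) x = 'D_v f x *m M.
Proof.
move=> df; rewrite !deriveE //; first exact: diff_mulmx.
exact: differentiable_mulmx.
Qed.

End MulmxDerivative.

Lemma jacobian_mulmx (R : realType) n m p (M : 'M[R]_(m, p))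
    (f : 'rV[R]_n -> 'rV[R]_m) x :
  differentiable f x -> 'J (fun u => f u *m M) x = 'J f x *m M.
Proof.
move=> df; apply/row_matrixP => i; rewrite row_mul !rowE !mul_rV_lin1.
exact: diff_mulmx.
Qed.

Lemma row2_sum (R : realType) (u : 'rV[R]_2) :
  u = u 0 0 *: delta_mx 0 0 + u 0 1 *: delta_mx 0 1.
Proof.
apply/rowP => j; rewrite !mxE /=.
by case: j => [[|[|//]]] jlt; rewrite /= ?mulr1 ?mulr0 ?addr0 ?add0r;
  congr (u _ _); apply/val_inj.
Qed.

Section SymmetricForm.
Variables (R : realType) (n : nat) (a b c : 'rV[R]_n).
Implicit Types Y Z : 'rV[R]_2.

Definition symform Y Z : 'rV[R]_n :=
  (Y 0 0 * Z 0 0) *: a + (Y 0 0 * Z 0 1 + Y 0 1 * Z 0 0) *: b +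
  (Y 0 1 * Z 0 1) *: c.

End SymmetricForm.

Lemma eq_symform (R : realType) n (a a' b b' c c' : 'rV[R]_n) Y Z :
  a = a' -> b = b' -> c = c' -> symform a b c Y Z = symform a' b' c' Y Z.
Proof. by move=> -> -> ->. Qed.

Lemma symform_mulmx (R : realType) n p (a b c : 'rV[R]_n) (M : 'M[R]_(n, p)) Y
  Z :
  symform (a *m M) (b *m M) (c *m M) Y Z = symform a b c Y Z *m M.
Proof. by rewrite /symform !mulmxDl !scalemxAl. Qed.

Section Hessian.
Variables (R : realType) (n : nat).
Implicit Types (f : 'rV[R]_2 -> 'rV[R]_n.+1) (q Y Z : 'rV[R]_2).

(** The second form before its normal part is taken: [perp] is right multiplication by a fixed
    matrix, so it can be applied after the bilinear combination. *)
Definition hess f q : 'rV[R]_2 -> 'rV[R]_2 -> 'rV[R]_n.+1 :=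
  symform (partial 0 (partial 0 f) q) (partial 1 (partial 0 f) q)
    (partial 1 (partial 1 f) q).

Lemma second_formE f q Y Z : second_form f q Y Z = perp f q (hess f q Y Z).
Proof. exact: symform_mulmx. Qed.

Lemma derive_partials f q Y : differentiable f q ->
  'D_Y f q = Y 0 0 *: partial 0 f q + Y 0 1 *: partial 1 f q.
Proof.
move=> df; rewrite /partial (deriveE Y df) (deriveE (delta_mx 0 0) df).
by rewrite (deriveE (delta_mx 0 1) df) {1}[Y]row2_sum linearD !linearZ.
Qed.

Variables (U : set 'rV[R]_2) (f : 'rV[R]_2 -> 'rV[R]_n.+1) (q : 'rV[R]_2).
Hypotheses (openU : open U) (Uq : U q) (smooth_f : smooth_on U f).

Let nearU : \forall u \near q, U u.
Proof. exact: open_nbhs_nbhs. Qed.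

Let dfU u : U u -> differentiable f u.
Proof. by move=> Uu; apply: (smooth_f [::]); rewrite inE. Qed.

Let dpU i u : U u -> differentiable (partial i f) u.
Proof. by move=> Uu; apply: (smooth_f [:: i]); rewrite inE. Qed.

(** Proved coordinate by coordinate, because [derive_sym] rests on the mean value theorem for real
    functions. *)
Lemma partial_sym : partial 0 (partial 1 f) q = partial 1 (partial 0 f) q.
Proof.
pose fj j u := f u 0 j.
have cD g j u (v : 'rV[R]_2) : differentiable g u ->
    ('D_v g u : 'rV[R]_n.+1) 0 j = 'D_v (fun x => g x 0 j) u.
  move=> dg; rewrite derive_mx ?mxE //; exact: diff_derivable.
have dc g j u : differentiable g u ->
    differentiable (fun x : 'rV[R]_2 => (g x : 'rV[R]_n.+1) 0 j : R) u.
  move=> dg; apply: (@differentiable_comp _ _ _ _ g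
    (fun N : 'rV[R]_n.+1 => N 0 j : R)) => //.
  exact: differentiable_coord.
apply/rowP => j.
have e1 := cD (partial 1 f) j q (delta_mx 0 0) (dpU 1 Uq).
have e0 := cD (partial 0 f) j q (delta_mx 0 1) (dpU 0 Uq).
apply: etrans e1 (etrans _ (esym e0)).
apply: (@derive_sym _ _ (fun u => f u 0 j) (fun u => partial 1 f u 0 j)
  (fun u => partial 0 f u 0 j) q); [|exact/dc/dpU|exact/dc/dpU].
near=> u; have Uu : U u by near: u.
by split; [exact/dc/dfU | exact/esym/cD/dfU ..].
Unshelve. all: by end_near. Qed.

Lemma derive2_hess Y Z : 'D_Z ('D_Y f) q = hess f q Y Z.
Proof.
pose p0 := partial 0 f; pose p1 := partial 1 f.
have Df : \forall u \near q, 'D_Y f u = (Y 0 0 *: p0 + Y 0 1 *: p1) u.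
  by near=> u; apply: derive_partials; apply: dfU; near: u.
have d0 : derivable p0 q Z by apply: diff_derivable; exact: dpU.
have d1 : derivable p1 q Z by apply: diff_derivable; exact: dpU.
rewrite (near_eq_derive _ Df).
have e0 := etrans (@deriveZ _ _ _ p0 (Y 0 0) q Z d0)
  (congr1 ( *:%R (Y 0 0)) (derive_partials Z (dpU 0 Uq))).
have e1 := etrans (@deriveZ _ _ _ p1 (Y 0 1) q Z d1)
  (congr1 ( *:%R (Y 0 1)) (derive_partials Z (dpU 1 Uq))).
apply: etrans (@deriveD _ _ _ (Y 0 0 *: p0) (Y 0 1 *: p1) q Z
  (derivableZ d0) (derivableZ d1)) _.
apply: etrans (congr2 +%R e0 e1) _.
have alg (y0 y1 z0 z1 : R) (a b b' c : 'rV[R]_n.+1) : b' = b ->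
    y0 *: (z0 *: a + z1 *: b) + y1 *: (z0 *: b' + z1 *: c) =
    (y0 * z0) *: a + (y0 * z1 + y1 * z0) *: b + (y1 * z1) *: c.
  by move=> ->; apply/rowP => j; rewrite !mxE; ring.
exact/alg/partial_sym.
Unshelve. all: by end_near. Qed.

(** An affine change of parameters has zero second derivative, so no first derivative of [f] enters.
    This is how the adapted parametrisation of the ellipse is brought back to the given
    coordinates. *)
Lemma partial2_affine (P : 'M[R]_2) i j :
  partial j (partial i (fun z => f (q + z *m P))) 0 =
  hess f q (row i P) (row j P).
Proof.
have E W i' (h : 'rV[R]_2 -> 'rV[R]_n.+1) :
   partial i' (fun z => h (q + z *m P)) W = 'D_(row i' P) h (q + W *m P).
  rewrite /partial /derive; set F := fun t => _; set G := fun t => _.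
  suff -> : F = G by [].
  apply/funext => t; rewrite /F /G /=; rewrite mulmxDl -scalemxAl -rowE.
  by rewrite addrCA addrC.
rewrite -derive2_hess.
have Ei : partial i (fun z => f (q + z *m P)) =
    (fun z => 'D_(row i P) f (q + z *m P)).
  by apply/funext => z; exact: E.
apply: etrans (congr1 (fun h => partial j h 0) Ei) _.
have q0 : q + 0 *m P = q by rewrite mul0mx addr0.
have := E 0 j ('D_(row i P) f); rewrite q0 => <-; reflexivity.
Qed.

End Hessian.

Lemma hess_mulmx (R : realType) n p (U : set 'rV[R]_2)
    (f : 'rV[R]_2 -> 'rV[R]_n.+1) (M : 'M[R]_(n.+1, p.+1)) q Y Z :
  open U -> U q -> smooth_on U f ->
  hess (fun u => f u *m M) q Y Z = hess f q Y Z *m M.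
Proof.
move=> openU Uq smooth_f.
have nearU : \forall u \near q, U u by exact: open_nbhs_nbhs.
have dfU u : U u -> differentiable f u.
  by move=> Uu; apply: (smooth_f [::]); rewrite inE.
have dpU i u : U u -> differentiable (partial i f) u.
  by move=> Uu; apply: (smooth_f [:: i]); rewrite inE.
have E i : \forall u \near q,
    partial i (fun u => f u *m M) u = partial i f u *m M.
  by near=> u; apply: derive_mulmx; apply: dfU; near: u.
have E2 i j :
    partial j (partial i (fun u => f u *m M)) q =
    partial j (partial i f) q *m M.
  by apply: etrans (near_eq_derive _ (E i)) _; apply/derive_mulmx/dpU.
rewrite -symform_mulmx.
exact: eq_symform (E2 0 0) (E2 0 1) (E2 1 1).
Unshelve. all: by end_near. Qed.

(** * Plane geometry *)

Section Circle.
Variable R : realType.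
Implicit Types x y : R.

(** The bounds on [t] are those of the parameter interval in [curvature_ellipse]. *)
Lemma circle_angle_2pi x y : x ^+ 2 + y ^+ 2 = 1 ->
  exists2 t, 0 <= t <= 2 * pi & x = cos t /\ y = sin t.
Proof.
move=> E; have x1 : -1 <= x <= 1 by have ? := sqr_ge0 y; apply/andP; split; nra.
have xK : cos (acos x) = x by rewrite acosK // in_itv.
have a0 := acos_ge0 x1; have api := acos_lepi x1; have pi0 := @pi_ge0 R.
have : sin (acos x) ^+ 2 = y ^+ 2 by rewrite sin2cos2 xK -E; ring.
move/eqP; rewrite eqf_sqr => /orP[/eqP e|/eqP e].
  by exists (acos x) => //; apply/andP; split; lra.
exists (2 * pi - acos x); first by apply/andP; split; lra.
have -> : 2 * pi - acos x = - acos x + pi *+ 2 by rewrite mulr2n; ring.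
by rewrite cosD2pi sinD2pi cosN sinN xK e opprK.
Qed.

Lemma circle_angle x y : x ^+ 2 + y ^+ 2 = 1 ->
  exists t, x = cos t /\ y = sin t.
Proof. by move=> /circle_angle_2pi[t _ ?]; exists t. Qed.

Lemma polar_coordinates x y : exists r t, x = r * cos t /\ y = r * sin t.
Proof.
pose r := Num.sqrt (x ^+ 2 + y ^+ 2).
have rE : r ^+ 2 = x ^+ 2 + y ^+ 2 by rewrite sqr_sqrtr // addr_ge0 ?sqr_ge0.
have [r0|r0] := eqVneq r 0.
  move: rE; rewrite r0 expr0n /= => /esym/eqP; rewrite paddr_eq0 ?sqr_ge0 //.
  rewrite !sqrf_eq0 => /andP[/eqP-> /eqP->].
  by exists 0, 0; rewrite !mul0r.
have [|t [xt yt]] := @circle_angle (x / r) (y / r).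
  by rewrite !exprMn -mulrDl -rE -exprMn divff // expr1n.
by exists r, t; rewrite -xt -yt !(mulrC r) !divfK.
Qed.

End Circle.

Section Plane.
Variable R : realType.
Implicit Types x y z : 'rV[R]_2.

(** The [det] of the overview, taken in coordinates of an orthonormal frame of the normal plane. *)
Definition wedge x y : R := x 0 0 * y 0 1 - x 0 1 * y 0 0.

Lemma rV2P x y : x 0 0 = y 0 0 -> x 0 1 = y 0 1 -> x = y.
Proof.
move=> e0 e1; apply/rowP; case=> [[|[|//]]] p.
  by rewrite (_ : Ordinal p = 0) //; apply/val_inj.
by rewrite (_ : Ordinal p = 1) //; apply/val_inj.
Qed.

Lemma wedge_cramer x y z :
  wedge x y *: z = wedge z y *: x + wedge x z *: y.
Proof. by apply/rV2P; rewrite /wedge !mxE; ring. Qed.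

Lemma wedge0_parallel x y : wedge x y = 0 -> x != 0 -> exists k, y = k *: x.
Proof.
move=> w0 x0.
have n0 : x 0 0 ^+ 2 + x 0 1 ^+ 2 != 0.
  apply: contraNneq x0 => /eqP; rewrite paddr_eq0 ?sqr_ge0 // !sqrf_eq0.
  by move=> /andP[/eqP e0 /eqP e1]; apply/eqP/rV2P; rewrite mxE.
(* The coefficient of the orthogonal projection of [y] onto [x]; the error in each coordinate is a
   multiple of [wedge x y]. *)
exists ((x 0 0 * y 0 0 + x 0 1 * y 0 1) / (x 0 0 ^+ 2 + x 0 1 ^+ 2)).
move: w0; rewrite /wedge => w0.
apply/rV2P; rewrite mxE; apply: (mulIf n0); rewrite mulrAC divfK //.
  by apply/eqP; rewrite -subr_eq0; apply/eqP;
    transitivity (- x 0 1 * (x 0 0 * y 0 1 - x 0 1 * y 0 0));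
      [ring|rewrite w0 mulr0].
by apply/eqP; rewrite -subr_eq0; apply/eqP;
  transitivity (x 0 0 * (x 0 0 * y 0 1 - x 0 1 * y 0 0));
    [ring|rewrite w0 mulr0].
Qed.

(** Unlike [wedge0_parallel], this treats [x] and [y] alike and allows both to vanish, while still
    giving a nonzero direction. *)
Lemma wedge0_common x y : wedge x y = 0 -> exists d k l,
  [/\ d != 0, x = k *: d & y = l *: d].
Proof.
move=> w0; have [x0|x0] := eqVneq x 0; last first.
  have [k ->] := wedge0_parallel w0 x0.
  by exists x, 1, k; rewrite scale1r.
have [y0|y0] := eqVneq y 0.
  exists (delta_mx 0 0), 0, 0; rewrite x0 y0 !scale0r; split=> //.
  by apply/eqP => /rowP/(_ 0); rewrite !mxE /= => /eqP; rewrite oner_eq0.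
by exists y, 0, 1; rewrite x0 scale0r scale1r.
Qed.

Lemma wedge0r x : wedge x 0 = 0.
Proof. by rewrite /wedge !mxE; ring. Qed.

Lemma wedge0l x : wedge 0 x = 0.
Proof. by rewrite /wedge !mxE; ring. Qed.

End Plane.

Section Dot.
Variables (R : realType) (n : nat).
Implicit Types u w d : 'rV[R]_n.

Lemma dotE u w : dot u w = \sum_j u 0 j * w 0 j.
Proof. by rewrite /dot mxE; apply: eq_bigr => j _; rewrite mxE. Qed.

Lemma dotC u w : dot u w = dot w u.
Proof. by rewrite !dotE; apply: eq_bigr => j _; rewrite mulrC. Qed.

Lemma dotDl u u' w : dot (u + u') w = dot u w + dot u' w.
Proof. by rewrite /dot mulmxDl mxE. Qed.

Lemma dotZl k u w : dot (k *: u) w = k * dot u w.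
Proof. by rewrite /dot -scalemxAl mxE. Qed.

Lemma dotDr u w w' : dot u (w + w') = dot u w + dot u w'.
Proof. by rewrite !(dotC u) dotDl. Qed.

Lemma dotZr k u w : dot u (k *: w) = k * dot u w.
Proof. by rewrite !(dotC u) dotZl. Qed.

Lemma dot_eq0 u : (dot u u == 0) = (u == 0).
Proof.
apply/eqP/eqP => [|->]; last by rewrite /dot mul0mx mxE.
rewrite dotE => /eqP; rewrite psumr_eq0; last by move=> j _;
  rewrite -expr2 sqr_ge0.
move=> /allP E; apply/rowP => j; have := E j (mem_index_enum j).
by rewrite /= -expr2 sqrf_eq0 mxE => /eqP.
Qed.

(** This contradicts the orthogonality of the axes in a standard equation as soon as the conic lies
    on a line. *)
Lemma parallel_orthogonal d k l : k *: d != 0 -> l *: d != 0 ->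
  dot (k *: d) (l *: d) != 0.
Proof.
rewrite !scaler_eq0 !negb_or => /andP[k0 d0] /andP[l0 _].
by rewrite dotZl dotZr !mulf_neq0 // dot_eq0.
Qed.

End Dot.

(** * Collinear sets, lines and half-lines *)

Section Collinear.
Variables (R : realType) (n : nat).
Implicit Types (D : set 'rV[R]_n.+1) (c d z : 'rV[R]_n.+1).

(** The direction [d] may be zero, so points are included: this one property separates the
    non-degenerate conics from all their degenerations. *)
Definition collinear D : Prop :=
  exists c d, D `<=` range (fun t : R => c + t *: d).

Lemma collinear_sub D a b x y x' y' : collinear D ->
  D x -> D x' -> D y -> D y' -> x - x' = a -> y - y' = b -> a != 0 -> b != 0 ->
  dot a b != 0.
Proof.
move=> [c [d sub]] /sub[t _ <-] /sub[t' _ <-] /sub[s _ <-] /sub[s' _ <-].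
have e (r r' : R) : (c + r *: d) - (c + r' *: d) = (r - r') *: d.
  by rewrite opprD addrACA subrr add0r scalerBl.
rewrite !e => <- <-; exact: parallel_orthogonal.
Qed.

(** The chords between opposite vertices are [2 a] and [2 b], which are nonzero and orthogonal. *)
Lemma ellipse_not_collinear D : is_ellipse D -> ~ collinear D.
Proof.
move=> [c [a [b [a0 b0 ab ->]]]] col.
have in_D t : range (fun t : R => c + cos t *: a + sin t *: b)
    (c + cos t *: a + sin t *: b) by exists t.
have := collinear_sub col (in_D 0) (in_D pi) (in_D (pi / 2)) (in_D (- (pi / 2)))
  erefl erefl.
rewrite cosN sinN cos0 sin0 cospi sinpi cos_pihalf sin_pihalf.
have -> : c + 1 *: a + 0 *: b - (c + -1 *: a + 0 *: b) = 2 *: a.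
  by apply/rowP => j; rewrite !mxE; ring.
have -> : c + 0 *: a + 1 *: b - (c + 0 *: a + -1 *: b) = 2 *: b.
  by apply/rowP => j; rewrite !mxE; ring.
rewrite dotZl dotZr ab !mulr0 eqxx !scaler_eq0 !negb_or a0 b0 pnatr_eq0 /=.
by move=> /(_ isT isT).
Qed.

(** The points at parameters [0], [1] and [-1] recover [a] and [b] by differences, so on a line both
    would be multiples of its direction. *)
Lemma parabola_not_collinear D : is_parabola D -> ~ collinear D.
Proof.
move=> [c [a [b [a0 b0 ab ->]]]] [c' [d sub]].
have in_D t : exists s, c' + s *: d = c + t *: a + t ^+ 2 *: b.
  by have [|s _ e] := sub (c + t *: a + t ^+ 2 *: b); [exists t | exists s].
have [s0 /rowP e0] := in_D 0; have [s1 /rowP e1] := in_D 1.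
have [s2 /rowP e2] := in_D (-1).
have aE : a = ((s1 - s2) / 2) *: d.
  by apply/rowP => j; have := e1 j; have := e2 j; rewrite !mxE; lra.
have bE : b = ((s1 + s2) / 2 - s0) *: d.
  by apply/rowP => j; have := e0 j; have := e1 j; have := e2 j; rewrite !mxE;
    lra.
by move: ab a0 b0; rewrite aE bE => ab a0 /(parallel_orthogonal a0);
  rewrite ab eqxx.
Qed.

Lemma sub_collinear D c d :
  D `<=` range (fun t : R => c + t *: d) -> collinear D.
Proof. by move=> ?; exists c, d. Qed.

Lemma segment_collinear D : is_segment D -> collinear D.
Proof.
move=> [a [b [_ ->]]]; exists a, (b - a) => _ [t _ <-]; exists t => //.
by apply/rowP => j; rewrite !mxE; ring.
Qed.

Lemma halfline_collinear D : is_halfline D -> collinear D.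
Proof. by move=> [d _ [c ->]]; exists c, d => _ [t _ <-]; exists t. Qed.

Lemma line_collinear D : is_line D -> collinear D.
Proof. by move=> [d _ [c ->]]; exists c, d => _ [t _ <-]; exists t. Qed.

Lemma halfline_not_line D : is_halfline D -> ~ is_line D.
Proof.
move=> [d d0 [c ->]] [e e0 [c' E]].
pose h (t : R) := c + t *: d.
have in0 : (h @` `[0, +oo[) (h 0) by exists 0; rewrite //= in_itv /= lexx.
have in1 : (h @` `[0, +oo[) (h 1) by exists 1; rewrite //= in_itv /= ler01.
move: in0 in1; rewrite E => -[s _ hs] [t _ ht].
have : range (fun t : R => c' + t *: e) (h (-1)).
  (* A line contains the reflection of the point at parameter [1] in the end point; the half-line
     does not. *)
  exists (2 * s - t) => //; move/rowP: hs => hs; move/rowP: ht => ht.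
  by apply/rowP => j; move: (hs j) (ht j); rewrite /h !mxE; lra.
rewrite -E => -[r]; rewrite /= in_itv /= andbT /h => r0 /addrI e1.
move/eqP: e1; rewrite -subr_eq0 -scalerBl scaler_eq0 (negPf d0) orbF => /eqP;
  lra.
Qed.

Lemma halfline_not_set1 z : ~ is_halfline [set z].
Proof.
move=> [d d0 [c E]].
have : [set z] (c + 0 *: d) by rewrite E; exists 0; rewrite //= in_itv /= lexx.
have : [set z] (c + 1 *: d) by rewrite E; exists 1; rewrite //= in_itv /= ler01.
move=> <- /addrI/eqP; rewrite -subr_eq0 -scalerBl scaler_eq0 (negPf d0) orbF.
by rewrite subr_eq0 eq_sym oner_eq0.
Qed.

Lemma line_not_set1 z : ~ is_line [set z].
Proof.
move=> [d d0 [c E]].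
have : [set z] (c + 0 *: d) by rewrite E; exists 0.
have : [set z] (c + 1 *: d) by rewrite E; exists 1.
move=> <- /addrI/eqP; rewrite -subr_eq0 -scalerBl scaler_eq0 (negPf d0) orbF.
by rewrite subr_eq0 eq_sym oner_eq0.
Qed.

Lemma segment_not_set1 z : ~ is_segment [set z].
Proof.
move=> [a [b [/eqP ab E]]]; apply: ab.
have : [set z] a.
  by rewrite E; exists 0;
    rewrite /= ?in_itv /= ?lexx ?ler01 // subr0 scale1r scale0r addr0.
have : [set z] b.
  by rewrite E; exists 1;
    rewrite /= ?in_itv /= ?lexx ?ler01 // subrr scale1r scale0r add0r.
by move=> -> ->.
Qed.

(** Two distinct points of [D] determine the line, so the existential definitions of [line_contains]
    and [line_avoids] can be tested on one explicit line. *)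
Lemma line_unique D L c d (s1 s2 : R) : d != 0 -> s1 != s2 ->
  D (c + s1 *: d) -> D (c + s2 *: d) -> is_line L -> D `<=` L ->
  L = range (fun t : R => c + t *: d).
Proof.
move=> d0 s12 D1 D2 [e e0 [c' ->]] sub.
have [t1 _ /rowP E1] := sub _ D1; have [t2 _ /rowP E2] := sub _ D2.
have t12 : t1 != t2.
  apply: contraNneq d0 => t12; apply/eqP/rowP => j.
  move: (E1 j) (E2 j); rewrite !mxE t12 => -> /addrI/eqP.
  by rewrite -subr_eq0 -mulrBl mulf_eq0 subr_eq0 (negPf s12) => /eqP.
have [st ts] : (s1 - s2 != 0) /\ (t1 - t2 != 0) by rewrite !subr_eq0.
pose k := (s1 - s2) / (t1 - t2).
have ek j : e 0 j = k * d 0 j.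
  apply: (mulfI ts); rewrite mulrA /k mulrCA divff // mulr1.
  by move: (E1 j) (E2 j); rewrite !mxE; lra.
have c'E j : c' 0 j = c 0 j + (s1 - t1 * k) * d 0 j.
  by move: (E1 j); rewrite !mxE ek; lra.
have k0 : k != 0 by rewrite mulf_neq0 // invr_eq0.
apply/seteqP; split=> _ [t _ <-].
  by exists (s1 - t1 * k + t * k) => //; apply/rowP => j; rewrite !mxE ek c'E;
    ring.
exists ((t - (s1 - t1 * k)) / k) => //.
by apply/rowP => j; rewrite !mxE ek c'E [_ * (k * _)]mulrA divfK //; ring.
Qed.

Section OnLine.
Variables (D : set 'rV[R]_n.+1) (c d : 'rV[R]_n.+1) (s1 s2 : R).
Hypotheses (d0 : d != 0) (s12 : s1 != s2).
Hypotheses (D1 : D (c + s1 *: d)) (D2 : D (c + s2 *: d)).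
Hypothesis sub : D `<=` range (fun t : R => c + t *: d).

Lemma line_containsE z : line_contains D z <-> exists t : R, c + t *: d = z.
Proof.
split=> [[L [lL DL]]|[t tz]].
  by rewrite (line_unique d0 s12 D1 D2 lL DL) => -[t _ tz]; exists t.
exists (range (fun t : R => c + t *: d)); split=> //; last by exists t.
by exists d => //; exists c.
Qed.

Lemma line_avoidsE z : line_avoids D z <-> ~ exists t : R, c + t *: d = z.
Proof.
split=> [[L [lL DL]]|nz].
  rewrite (line_unique d0 s12 D1 D2 lL DL) => nL [t tz]; apply: nL.
  by exists t.
exists (range (fun t : R => c + t *: d)); split=> //.
  by exists d => //; exists c.
by move=> [t _ tz]; apply: nz; exists t.
Qed.

End OnLine.

End Collinear.

(** * Conics in an embedded plane *)

Section Component.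
Variables (R : realType) (T : topologicalType) (A : set T).

(** The image of the component under [phi] is an interval that misses [k], so it stays on the side
    of [phi z]. *)
Lemma connected_component_lt (phi : T -> R) (k : R) (z : T) :
  continuous phi -> (forall x, A x -> phi x != k) -> phi z < k ->
  connected_component A z `<=` [set x | phi x < k].
Proof.
move=> cphi Ak zk x zx; rewrite /= ltNge; apply/negP => kx.
have /connected_intervalP I : connected (phi @` connected_component A z).
  apply: connected_continuous_connected; first exact: component_connected.
  exact: continuous_subspaceT.
(* Otherwise the component of [z] would be empty, contrary to [zx]. *)
have Az : A z.
  by have [//|/connected_component_out] := pselect (A z);
    move: zx => /[swap] ->.
have [|||y zy yk] := I (phi z) (phi x) _ _ k.
- by exists z => //; exact: connected_component_refl.
- by exists x.
- by rewrite (ltW zk).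
by have := Ak y (connected_component_sub zy); rewrite yk eqxx.
Qed.

Lemma connected_component_path (gamma : R -> T) :
  continuous gamma -> (forall t, 0 <= t <= 1 -> A (gamma t)) ->
  connected_component A (gamma 0) (gamma 1).
Proof.
move=> cgamma Agamma.
have in01 (t : R) : 0 <= t <= 1 -> (gamma @` `[0, 1]) (gamma t).
  by move=> t01; exists t; rewrite //= in_itv.
exists (gamma @` `[0, 1]); last by apply: in01; rewrite lexx ler01.
split.
- by apply: in01; rewrite lexx ler01.
- by move=> _ [t + <-]; rewrite /= in_itv /=; exact: Agamma.
- apply: connected_continuous_connected; first exact: segment_connected.
  exact: continuous_subspaceT.
Qed.

End Component.

Section EmbeddedPlane.
Variables (R : realType) (n : nat) (F : 'M[R]_(2, n.+1)).
Hypothesis FF : F *m F^T = 1%:M.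
Implicit Types (a b c d x y : 'rV[R]_2) (z : 'rV[R]_n.+1).

Definition rowspan : set 'rV[R]_n.+1 := [set z | (z <= F)%MS].

Lemma rowspanP z : rowspan z <-> exists y, z = y *m F.
Proof. by split=> [/submxP[y ->]|[y ->]]; [exists y | exact: submxMl]. Qed.

Lemma frameK y : y *m F *m F^T = y.
Proof. by rewrite -mulmxA FF mulmx1. Qed.

Lemma frame_inj : injective (fun y => y *m F).
Proof. by move=> x y /(congr1 (mulmx^~ F^T)); rewrite /= !frameK. Qed.

Lemma frame_eq0 y : (y *m F == 0) = (y == 0).
Proof. by rewrite -(inj_eq frame_inj) mul0mx. Qed.

Lemma dot_frame x y : dot (x *m F) (y *m F) = dot x y.
Proof. by rewrite /dot trmx_mul mulmxA frameK. Qed.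

Lemma dot2E x y : dot x y = x 0 0 * y 0 0 + x 0 1 * y 0 1.
Proof.
rewrite dotE big_ord_recl big_ord1.
by rewrite (_ : lift ord0 ord0 = 1 :> 'I_2) //; apply/val_inj.
Qed.

(** Passage from conjugate half-diameters to principal axes. The product [dot a' b'] is a linear
    combination of the cosine and sine of the double angle, and [polar_coordinates] supplies a zero
    of it. Rotation preserves [wedge], which keeps [a'] and [b'] nonzero. *)
Lemma rotate_orthogonal a b : wedge a b != 0 -> exists t,
  let a' := cos t *: a + sin t *: b in
  let b' := - sin t *: a + cos t *: b in
  [/\ a' != 0, b' != 0 & dot a' b' = 0].
Proof.
move=> w0.
have [r [t [qE pE]]] :=
  polar_coordinates ((dot b b - dot a a) / 2) (- dot a b).
exists (t / 2); set a' := _ + _; set b' := _ + _ => /=.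
have w' : wedge a' b' = wedge a b.
  transitivity ((cos (t / 2) ^+ 2 + sin (t / 2) ^+ 2) * wedge a b).
    by rewrite /wedge /a' /b' !mxE; ring.
  by rewrite cos2Dsin2 mul1r.
split.
- by apply: contraNneq w0 => a0; rewrite -w' a0 wedge0l.
- by apply: contraNneq w0 => b0; rewrite -w' b0 wedge0r.
have tE : t = t / 2 + t / 2 by field.
have ct : cos t = cos (t / 2) ^+ 2 - sin (t / 2) ^+ 2.
  by rewrite {1}tE cosD !expr2.
have st : sin t = 2 * (cos (t / 2) * sin (t / 2)).
  by rewrite {1}tE sinD; ring.
have -> : dot a' b' = dot a b * cos t + (dot b b - dot a a) / 2 * sin t.
  by rewrite ct st /a' /b' !dotDl !dotDr !dotZl !dotZr (dotC b a); field.
by rewrite qE -[dot a b]opprK pE; ring.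
Qed.

(** Here [a] and [b] are only conjugate half-diameters, not necessarily orthogonal, and they may be
    parallel or zero. *)
Definition emb_ellipse c a b : set 'rV[R]_n.+1 :=
  range (fun t : R => (c + cos t *: a + sin t *: b) *m F).

(** The arguments are ordered by degree in [t]; [a] gives the direction of the axis. *)
Definition emb_parabola c b a : set 'rV[R]_n.+1 :=
  range (fun t : R => (c + t *: b + t ^+ 2 *: a) *m F).

Lemma is_ellipse_emb c a b : wedge a b != 0 -> is_ellipse (emb_ellipse c a b).
Proof.
move=> /rotate_orthogonal[t0 [a0 b0 ab]].
set a' := _ + _ in a0 ab; set b' := _ + _ in b0 ab.
exists (c *m F), (a' *m F), (b' *m F); rewrite !frame_eq0 dot_frame; split=> //.
have E t : c *m F + cos t *: (a' *m F) + sin t *: (b' *m F) =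
    (c + cos (t + t0) *: a + sin (t + t0) *: b) *m F.
  rewrite !scalemxAl -!mulmxDl; congr (_ *m F).
  by rewrite cosD sinD; apply/rowP => j; rewrite !mxE; ring.
apply/seteqP; split=> _ [t _ <-].
  by exists (t - t0); rewrite // E subrK.
by exists (t + t0); rewrite // E.
Qed.

Lemma is_parabola_emb c b a : wedge a b != 0 ->
  is_parabola (emb_parabola c b a).
Proof.
move=> w0; have a0 : a != 0 by apply: contraNneq w0 => ->; rewrite wedge0l.
(* The parameter of the vertex, where the tangent [b + 2 t0 a] is orthogonal to the axis direction
   [a]. *)
pose t0 := - dot a b / (2 * dot a a).
pose b' := b + (2 * t0) *: a.
have ab : dot b' a = 0.
  rewrite /b' dotDl dotZl (dotC b a) /t0; field.
  by rewrite dot_eq0 a0.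
have b0 : b' != 0.
  by apply: contraNneq w0 => b0; rewrite -(wedge0r a) -b0 /b' /wedge !mxE;
    apply/eqP; ring.
pose c' := c + t0 *: b + t0 ^+ 2 *: a.
exists (c' *m F), (b' *m F), (a *m F); rewrite !frame_eq0 dot_frame; split=> //.
have E t : c' *m F + t *: (b' *m F) + t ^+ 2 *: (a *m F) =
    (c + (t + t0) *: b + (t + t0) ^+ 2 *: a) *m F.
  rewrite !scalemxAl -!mulmxDl; congr (_ *m F).
  by apply/rowP => j; rewrite !mxE; ring.
apply/seteqP; split=> _ [t _ <-].
  by exists (t - t0); rewrite // E subrK.
by exists (t + t0); rewrite // E.
Qed.

Lemma emb_ellipse_line c d k l : emb_ellipse c (k *: d) (l *: d) `<=`
  range (fun t : R => c *m F + t *: (d *m F)).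
Proof.
move=> _ [t _ <-]; exists (cos t * k + sin t * l) => //.
rewrite scalemxAl -mulmxDl; congr (_ *m F).
by apply/rowP => j; rewrite !mxE; ring.
Qed.

Lemma emb_parabola_line c d k l : emb_parabola c (k *: d) (l *: d) `<=`
  range (fun t : R => c *m F + t *: (d *m F)).
Proof.
move=> _ [t _ <-]; exists (t * k + t ^+ 2 * l) => //.
rewrite scalemxAl -mulmxDl; congr (_ *m F).
by apply/rowP => j; rewrite !mxE; ring.
Qed.

Lemma is_ellipse_embE c a b :
  is_ellipse (emb_ellipse c a b) <-> wedge a b != 0.
Proof.
split; last exact: is_ellipse_emb.
move=> /ellipse_not_collinear ncol; apply/eqP => /wedge0_common.
move=> [d [k [l [_ aE bE]]]]; apply: ncol; rewrite aE bE.
exact: sub_collinear (@emb_ellipse_line c d k l).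
Qed.

Lemma is_parabola_embE c b a :
  is_parabola (emb_parabola c b a) <-> wedge a b != 0.
Proof.
split; last exact: is_parabola_emb.
move=> /parabola_not_collinear ncol; apply/eqP => /wedge0_common.
move=> [d [k [l [_ aE bE]]]]; apply: ncol; rewrite aE bE.
exact: sub_collinear (@emb_parabola_line c d l k).
Qed.

Lemma origin_on_line c d : d != 0 ->
  (exists t : R, c *m F + t *: (d *m F) = 0) <-> wedge d c = 0.
Proof.
move=> d0; split=> [[t]|/wedge0_parallel/(_ d0)[t ->]].
  rewrite scalemxAl -mulmxDl => /eqP; rewrite frame_eq0 => /eqP/rowP e.
  have := e 0; have := e 1; rewrite !mxE /wedge => e1 e0.
  have -> : c 0 0 = - (t * d 0 0) by lra.
  have -> : c 0 1 = - (t * d 0 1) by lra.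
  ring.
by exists (- t); rewrite scalemxAl -mulmxDl scaleNr subrr mul0mx.
Qed.

(** The last clause rids callers of the auxiliary direction [d]: conditions on it are translated
    back to [a] and [b]. *)
Lemma emb_ellipse_segment c a b : wedge a b = 0 -> (a != 0) || (b != 0) ->
  exists d, [/\ d != 0, is_segment (emb_ellipse c a b),
    (line_contains (emb_ellipse c a b) 0 <-> wedge d c = 0),
    (line_avoids (emb_ellipse c a b) 0 <-> wedge d c <> 0) &
    wedge d c = 0 <-> wedge a c = 0 /\ wedge b c = 0].
Proof.
move=> /wedge0_common[d [k [l [d0 -> ->]]]] ab0.
(* The curve is traversed by [c + r cos (t - t0) d]. *)
have [r [t0 [kE lE]]] := polar_coordinates k l.
have r0 : r != 0.
  apply: contraTneq ab0 => r0; rewrite kE lE r0 !mul0r !scale0r !eqxx //.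
have dF0 : d *m F != 0 by rewrite frame_eq0.
set D := emb_ellipse _ _ _.
have D_in (s : R) : -1 <= s <= 1 -> D (c *m F + (r * s) *: (d *m F)).
  move=> s1; exists (acos s + t0) => //; rewrite cosD sinD acosK ?in_itv //.
  rewrite !scalemxAl -mulmxDl; congr (_ *m F); rewrite kE lE.
  have := cos2Dsin2 t0 => c2; apply/rowP => j; rewrite !mxE.
  rewrite -[in RHS](mulr1 r) -c2; ring.
have D1 : D (c *m F + (r * 1) *: (d *m F)) by apply: D_in; apply/andP; split;
  lra.
have D2 : D (c *m F + (r * -1) *: (d *m F)) by apply: D_in; apply/andP; split;
  lra.
have r12 : r * 1 != r * -1.
  by rewrite -subr_eq0 -mulrBr mulf_neq0 // opprK; apply/eqP; lra.
have sub := @emb_ellipse_line c d k l.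
exists d; split=> //.
- exists ((c - r *: d) *m F), ((c + r *: d) *m F); split.
    rewrite (inj_eq frame_inj); apply: contraNneq d0 => /eqP.
    rewrite -subr_eq0 opprD addrACA subrr add0r -scaleNr -scalerDl.
    by rewrite scaler_eq0 => /orP[|//]; move: r0 => /eqP r0 /eqP; lra.
  have E t : (1 - t) *: ((c - r *: d) *m F) + t *: ((c + r *: d) *m F) =
      c *m F + (r * (2 * t - 1)) *: (d *m F).
    rewrite !scalemxAl -!mulmxDl; congr (_ *m F).
    by apply/rowP => j; rewrite !mxE; ring.
  apply/seteqP; split=> [_ [t _ <-]|x [t]].
    exists ((1 + cos (t - t0)) / 2).
      have := cos_le1 (t - t0); have := cos_geN1 (t - t0).
      by rewrite /= in_itv /= => ? ?; apply/andP; split; lra.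
    rewrite E !scalemxAl -mulmxDl; congr (_ *m F); rewrite kE lE cosB.
    by apply/rowP => j; rewrite !mxE; field.
  rewrite /= in_itv /= => t01 <-; rewrite E; apply: D_in; lra.
- by rewrite (line_containsE dF0 r12 D1 D2 sub) origin_on_line.
- by rewrite (line_avoidsE dF0 r12 D1 D2 sub) origin_on_line.
have wZ (m : R) x y : wedge (m *: x) y = m * wedge x y.
  by rewrite /wedge !mxE; ring.
rewrite !wZ; split=> [->|[/eqP + /eqP]]; first by rewrite !mulr0.
rewrite !mulf_eq0 => /orP[/eqP k0|/eqP //] /orP[/eqP l0|/eqP //].
by move: ab0; rewrite k0 l0 !scale0r eqxx.
Qed.

Lemma emb_ellipse_set1 c : emb_ellipse c 0 0 = [set c *m F].
Proof.
apply/seteqP; split=> [_ [t _ <-]|_ ->]; last exists 0 => //;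
by rewrite /= !scaler0 !addr0.
Qed.

Lemma emb_parabola_set1 c : emb_parabola c 0 0 = [set c *m F].
Proof.
apply/seteqP; split=> [_ [t _ <-]|_ ->]; last exists 0 => //;
by rewrite /= !scaler0 !addr0.
Qed.

Lemma emb_ellipse_point c a b z : emb_ellipse c a b = [set z] ->
  [/\ a = 0, b = 0 & z = c *m F].
Proof.
move=> E.
have P t : (c + cos t *: a + sin t *: b) *m F = z.
  by have : emb_ellipse c a b ((c + cos t *: a + sin t *: b) *m F);
    [exists t | rewrite E].
have := P 0; have := P pi; have := P (pi / 2); have := P (- (pi / 2)).
rewrite cosN sinN cos0 sin0 cospi sinpi cos_pihalf sin_pihalf.
move=> <- /frame_inj/rowP e1 /frame_inj/rowP e2 /frame_inj/rowP e3.
have a0 : a = 0.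
  by apply/rowP => j; move: (e2 j) (e3 j); rewrite !mxE; lra.
have b0 : b = 0.
  by apply/rowP => j; move: (e1 j); rewrite !mxE; lra.
by split=> //; rewrite a0 b0 !scaler0 !addr0.
Qed.

Lemma emb_parabola_point c b a z : emb_parabola c b a = [set z] ->
  [/\ a = 0, b = 0 & z = c *m F].
Proof.
move=> E.
have P t : (c + t *: b + t ^+ 2 *: a) *m F = z.
  by have : emb_parabola c b a ((c + t *: b + t ^+ 2 *: a) *m F);
    [exists t | rewrite E].
have := P 0; have := P 1; have := P (-1); rewrite expr0n /= expr1n sqrrN expr1n.
move=> <- /frame_inj/rowP e1 /frame_inj/rowP e2.
have b0 : b = 0.
  by apply/rowP => j; move: (e1 j); rewrite !mxE; lra.
have a0 : a = 0.
  by apply/rowP => j; move: (e2 j); rewrite b0 !mxE; lra.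
by split=> //; rewrite a0 b0 !scaler0 !addr0.
Qed.

Lemma emb_parabola_isline c b : b != 0 -> is_line (emb_parabola c b 0).
Proof.
move=> b0; exists (b *m F); first by rewrite frame_eq0.
exists (c *m F); congr (_ @` _); apply/funext => t.
by rewrite scaler0 addr0 mulmxDl scalemxAl.
Qed.

Lemma emb_parabola_ishalfline c b a : a != 0 -> wedge a b = 0 ->
  let D := emb_parabola c b a in
  [/\ is_halfline D, line_contains D 0 <-> wedge a c = 0 &
    line_avoids D 0 <-> wedge a c <> 0].
Proof.
move=> a0 /wedge0_parallel/(_ a0)[k ->] D.
have aF0 : a *m F != 0 by rewrite frame_eq0.
(* Completing the square in [t k + t ^+ 2]; [c0] is the end point of the half-line. *)
pose c0 := c - (k ^+ 2 / 4) *: a.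
have DE t : (c + t *: (k *: a) + t ^+ 2 *: a) *m F =
    c0 *m F + (t + k / 2) ^+ 2 *: (a *m F).
  rewrite scalemxAl -mulmxDl; congr (_ *m F).
  by apply/rowP => j; rewrite !mxE; field.
have D_in s : 0 <= s -> D (c0 *m F + s *: (a *m F)).
  by move=> s0; exists (Num.sqrt s - k / 2); rewrite // DE subrK sqr_sqrtr.
have D0 := D_in 0 (lexx 0); have D1 := D_in 1 ler01.
have s01 : 0 != 1 :> R by rewrite eq_sym oner_eq0.
have sub : D `<=` range (fun t : R => c0 *m F + t *: (a *m F)).
  by move=> _ [t _ <-]; rewrite DE; exists ((t + k / 2) ^+ 2).
have wc : wedge a c0 = wedge a c by rewrite /wedge !mxE; ring.
split.
- exists (a *m F) => //; exists (c0 *m F); apply/seteqP.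
  split=> [_ [t _ <-]|x [t]]; last first.
    by rewrite /= in_itv /= andbT => t0 <-; exact: D_in.
  by exists ((t + k / 2) ^+ 2); rewrite ?DE // /= in_itv /= sqr_ge0.
- by rewrite (line_containsE aF0 s01 D0 D1 sub) origin_on_line // wc.
- by rewrite (line_avoidsE aF0 s01 D0 D1 sub) origin_on_line // wc.
Qed.

End EmbeddedPlane.

(** * Position of the origin with respect to a conic *)

Section Sides.
Variables (R : realType) (n : nat) (F : 'M[R]_(2, n.+1)).
Hypothesis FF : F *m F^T = 1%:M.
Implicit Types (a b c d x y : 'rV[R]_2) (z : 'rV[R]_n.+1).

Lemma continuous_wedge_frame c d :
  continuous (fun z => wedge d (z *m F^T - c) : R).
Proof.
have cj j : continuous (fun z => (z *m F^T - c) 0 j : R).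
  move=> z; apply: (@continuous_comp _ _ _ (fun z => z *m F^T - c)
    (fun y : 'rV[R]_2 => y 0 j : R)); last exact: coord_continuous.
  apply: continuousB; last exact: cst_continuous.
  exact: continuous_mulmxr.
have cm (k : R) j : continuous (fun z => k * (z *m F^T - c) 0 j : R).
  by move=> z; apply: (@continuousM _ _ (cst k));
    [exact: cst_continuous | exact: cj].
by move=> z; apply: (continuousB (cm _ _ z) (cm _ _ z)).
Qed.

Lemma continuous_frame_path (f g : R -> R) c a b :
  continuous f -> continuous g ->
  continuous (fun t => (c + f t *: a + g t *: b) *m F).
Proof.
move=> cf cg t.
have -> : (fun t => (c + f t *: a + g t *: b) *m F) =
    (fun t => c *m F + f t *: (a *m F) + g t *: (b *m F)).
  by apply/funext => s; rewrite !scalemxAl -!mulmxDl.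
have cZ (h : R -> R) (u : 'rV[R]_n.+1) : continuous h ->
  {for t, continuous (fun s => h s *: u)}.
  by move=> ch; exact: (continuousZr_tmp (ch t)).
have c0 : {for t, continuous (fun _ : R => c *m F)} by exact: cst_continuous.
exact: (continuousD (continuousD c0 (cZ f (a *m F) cf)) (cZ g (b *m F) cg)).
Qed.

Section Ellipse.
Variables (c a b : 'rV[R]_2).
Hypothesis w0 : wedge a b != 0.
Local Notation D := (emb_ellipse F c a b).
Let S := rowspan F `\` D.
(** By Cramer's rule, on the plane this is [wedge a b ^+ 2] times the squared radius in the affine
    coordinates with origin [c] and basis [a], [b]. *)
Let phi z := wedge b (z *m F^T - c) ^+ 2 + wedge a (z *m F^T - c) ^+ 2.

Let cphi : continuous phi.
Proof.
have cX u : continuous (fun z => wedge u (z *m F^T - c) ^+ 2).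
  have cu := @continuous_wedge_frame c u.
  by move=> z; exact: (continuousM (cu z) (cu z)).
by move=> z; exact: (continuousD (cX b z) (cX a z)).
Qed.

Let frame_coord z : rowspan F z ->
  z = (c + (- wedge b (z *m F^T - c) / wedge a b) *: a +
       (wedge a (z *m F^T - c) / wedge a b) *: b) *m F.
Proof.
move=> /(rowspanP F)[y ->]; rewrite (frameK FF); congr (_ *m F).
have := wedge_cramer a b (y - c) => /(congr1 (fun v => (wedge a b)^-1 *: v)).
rewrite /= scalerA mulVf // scale1r scalerDr !scalerA => e.
rewrite -{1}(subrK c y) {1}e addrC addrA ![(wedge a b)^-1 * _]mulrC.
by congr (_ + _ / _ *: _ + _); rewrite /wedge; ring.
Qed.

Let mem_emb_ellipse z : rowspan F z -> D z <-> phi z = wedge a b ^+ 2.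
Proof.
move=> Pz; split=> [[t _ <-]|zw].
  rewrite /phi (frameK FF) -[RHS]mulr1 -(cos2Dsin2 t) /wedge !mxE; ring.
have [|t [ct st]] := @circle_angle R (- wedge b (z *m F^T - c) / wedge a b)
  (wedge a (z *m F^T - c) / wedge a b).
  by rewrite !exprMn sqrrN -mulrDl -[X in X * _]/(phi z) zw exprVn divff //
    expf_neq0.
by exists t; rewrite // -ct -st -frame_coord.
Qed.

(** Moving from the origin straight away from the centre multiplies [phi] by [(1 + r t) ^+ 2], so a
    ray from an outer origin never meets the curve and the component is unbounded. For an inner
    origin the component stays where both affine coordinates are at most 1 in absolute value. *)
Lemma inside_emb_ellipse :
  inside_ellipse (rowspan F) D 0 <->
  wedge b c ^+ 2 + wedge a c ^+ 2 < wedge a b ^+ 2.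
Proof.
have P0 : rowspan F 0 by exact: sub0mx.
have phi0 : phi 0 = wedge b c ^+ 2 + wedge a c ^+ 2.
  by rewrite /phi mul0mx /wedge !mxE; ring.
have neS z : S z -> phi z != wedge a b ^+ 2.
  by move=> [Pz nDz]; apply: contra_notN nDz => /eqP /mem_emb_ellipse; exact.
have inS z : rowspan F z -> phi z != wedge a b ^+ 2 -> S z.
  by move=> Pz /eqP nz; split=> // /(mem_emb_ellipse Pz).
rewrite -phi0; split=> [[S0 bnd]|lt0].
  rewrite ltNge le_eqVlt eq_sym (negPf (neS 0 S0)) /=; apply/negP => gt0.
  have c0 : c != 0.
    apply: contraTneq gt0 => c0; rewrite phi0 c0 !wedge0r.
    by rewrite expr0n /= addr0 -leNgt sqr_ge0.
  have [M [_ HM]] := bnd.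
  (* The end point [- r c] gets norm [|M| + 2], which exceeds the bound [|M| + 1] obtained from
     [HM]. *)
  pose r := (`|M| + 2) / `|c *m F|.
  have cF0 : 0 < `|c *m F| by rewrite normr_gt0 frame_eq0.
  have r0 : 0 <= r by rewrite divr_ge0 // addr_ge0.
  pose gamma (t : R) := (0 + t *: (- r *: c) + 0 *: c) *m F.
  have cg : continuous gamma.
    by apply: continuous_frame_path => t;
      [exact: cvg_id | exact: cst_continuous].
  have comp : connected_component S (gamma 0) (gamma 1).
    apply: connected_component_path => // t /andP[t0 _].
    apply: inS; first exact: submxMl.
    have -> : phi (gamma t) = (1 + r * t) ^+ 2 * phi 0.
      by rewrite phi0 /phi /gamma (frameK FF) /wedge !mxE; ring.
    apply/eqP => e.
    have : phi 0 <= wedge a b ^+ 2.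
      rewrite -e -[leLHS]mul1r ler_wpM2r //.
        by rewrite phi0 addr_ge0 ?sqr_ge0.
      by have ? : 0 <= r * t; [exact: mulr_ge0 | nra].
    by rewrite leNgt gt0.
  have g0 : gamma 0 = 0.
    by rewrite /gamma !scale0r !addr0 mul0mx.
  have g1 : gamma 1 = - r *: (c *m F).
    by rewrite /gamma scale1r scale0r addr0 add0r scalemxAl.
  rewrite g0 g1 in comp.
  have ltM : M < `|M| + 1 by have ? : M <= `|M|; [exact: ler_norm | lra].
  have : `|- r *: (c *m F)| <= `|M| + 1 := HM _ ltM _ comp.
  rewrite normrZ normrN (ger0_norm r0) /r divfK ?gt_eqF //; lra.
split.
  by apply: inS => //; rewrite lt_eqF.
have sub := connected_component_lt cphi neS lt0.
exists (`|c *m F| + `|a *m F| + `|b *m F|); split; first exact: num_real.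
move=> M ltM z comp; apply: le_trans (ltW ltM).
have [Pz _] := connected_component_sub comp.
have := sub z comp; rewrite /= /phi => lt1.
have w2 : 0 < wedge a b ^+ 2 by rewrite lt_neqAle sqr_ge0 eq_sym expf_neq0.
have bd (k : R) : k ^+ 2 < wedge a b ^+ 2 -> `|k / wedge a b| <= 1.
  move=> k1; rewrite normrM normfV ler_pdivrMr ?normr_gt0 // mul1r.
  by rewrite -(ler_pXn2r (n := 2)) ?nnegrE // !real_normK ?num_real // ltW.
rewrite (frame_coord Pz) !mulmxDl -!scalemxAl.
apply: le_trans (ler_normD _ _) _; apply: lerD; last first.
  rewrite normrZ -[leRHS]mul1r ler_wpM2r // bd //.
  by apply: le_lt_trans lt1; rewrite lerDr sqr_ge0.
apply: le_trans (ler_normD _ _) _; apply: lerD; first by [].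
rewrite normrZ -[leRHS]mul1r ler_wpM2r // bd // sqrrN.
by apply: le_lt_trans lt1; rewrite lerDl sqr_ge0.
Qed.

Lemma on_emb_ellipse : D 0 <-> wedge b c ^+ 2 + wedge a c ^+ 2 = wedge a b ^+ 2.
Proof.
rewrite mem_emb_ellipse ?/phi ?mul0mx; last exact: sub0mx.
by rewrite (_ : wedge b _ ^+ 2 + _ = wedge b c ^+ 2 + wedge a c ^+ 2) //
  /wedge !mxE; ring.
Qed.

Lemma outside_emb_ellipse :
  outside_ellipse (rowspan F) D 0 <->
  wedge a b ^+ 2 < wedge b c ^+ 2 + wedge a c ^+ 2.
Proof.
split=> [[_ /on_emb_ellipse/eqP nD /inside_emb_ellipse/negP]|gt0].
  by rewrite -leNgt le_eqVlt eq_sym (negPf nD).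
split; first exact: sub0mx.
  by move=> /on_emb_ellipse e; rewrite e ltxx in gt0.
by move=> /inside_emb_ellipse lt0; have := lt_trans gt0 lt0; rewrite ltxx.
Qed.

End Ellipse.

Section Parabola.
Variables (c b a : 'rV[R]_2).
Hypothesis w0 : wedge a b != 0.
Local Notation D := (emb_parabola F c b a).
Let S := rowspan F `\` D.
Local Notation w := (wedge a b).
(** At [c + s b + u a] this is [w ^+ 2 * (s ^+ 2 - u)], see [phi_param]: zero on the parabola and
    negative on its convex side. *)
Let phi z := wedge a (z *m F^T - c) ^+ 2 + w * wedge b (z *m F^T - c).

Let cphi : continuous phi.
Proof.
have ca := @continuous_wedge_frame c a; have cb := @continuous_wedge_frame c b.
move=> z; apply: (continuousD (continuousM (ca z) (ca z))).
by apply: (continuousM _ (cb z)); exact: cst_continuous.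
Qed.

Let frame_coord z : rowspan F z ->
  z = (c + (wedge a (z *m F^T - c) / w) *: b +
       (- wedge b (z *m F^T - c) / w) *: a) *m F.
Proof.
move=> /(rowspanP F)[y ->]; rewrite (frameK FF); congr (_ *m F).
have := wedge_cramer a b (y - c) => /(congr1 (fun v => w^-1 *: v)).
rewrite /= scalerA mulVf // scale1r scalerDr !scalerA => e.
rewrite -{1}(subrK c y) {1}e addrC addrA addrAC ![w^-1 * _]mulrC.
by congr (_ + _ + _ / _ *: _); rewrite /wedge; ring.
Qed.

Let phi_param s u : phi ((c + s *: b + u *: a) *m F) = w ^+ 2 * (s ^+ 2 - u).
Proof. by rewrite /phi (frameK FF) /wedge !mxE; ring. Qed.

Let mem_emb_parabola z : rowspan F z -> D z <-> phi z = 0.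
Proof.
move=> Pz; split=> [[t _ <-]|]; first by rewrite phi_param subrr mulr0.
rewrite {1}(frame_coord Pz) phi_param => /eqP.
rewrite mulf_eq0 expf_eq0 /= (negPf w0) /= subr_eq0 => /eqP e.
by exists (wedge a (z *m F^T - c) / w); rewrite // e -frame_coord.
Qed.

(** From an origin with [phi 0 > 0], both [c + b] and [c - b] can be reached without crossing the
    curve, but their midpoint [c] lies on it, so the component is not convex. If [phi 0 < 0], the
    component stays in [phi < 0], and so do the segments between its points. *)
Lemma inside_emb_parabola :
  inside_parabola (rowspan F) D 0 <-> wedge a c ^+ 2 < w * wedge b c.
Proof.
have P0 : rowspan F 0 by exact: sub0mx.
have phi0 : phi 0 = wedge a c ^+ 2 - w * wedge b c.
  by rewrite /phi mul0mx /wedge !mxE; ring.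
have neS z : S z -> phi z != 0.
  by move=> [Pz nDz]; apply: contra_notN nDz => /eqP /mem_emb_parabola; exact.
have inS z : rowspan F z -> phi z != 0 -> S z.
  by move=> Pz /eqP nz; split=> // /(mem_emb_parabola Pz).
have w2 : 0 < w ^+ 2 by rewrite lt_neqAle sqr_ge0 eq_sym expf_neq0.
rewrite -subr_lt0 -phi0; split=> [[S0 conv]|lt0].
  rewrite ltNge le_eqVlt eq_sym (negPf (neS 0 S0)) /=; apply/negP => gt0.
  pose s := wedge a (0 *m F^T - c) / w; pose u := - wedge b (0 *m F^T - c) / w.
  have E0 : 0 = (c + s *: b + u *: a) *m F := frame_coord P0.
  have su : 0 < s ^+ 2 - u by move: gt0; rewrite E0 phi_param pmulr_rgt0.
  have comp (e : R) : e ^+ 2 = 1 -> connected_component S 0 ((c + e *: b) *m F).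
    move=> e1; pose f (t : R) := s + t * (e - s).
    (* Along the path the gap [f ^+ 2 - g] runs linearly from the positive value at the origin to
       [1], its value at [c + e b], so it never vanishes. *)
    pose g (t : R) := f t * f t - ((s ^+ 2 - u) + t * (1 - (s ^+ 2 - u))).
    have cl (k l : R) : continuous (fun t : R => k + t * l).
      move=> t; apply: (continuousD (@cst_continuous _ _ k t)).
      by apply: continuousM; [exact: cvg_id | exact: cst_continuous].
    have cf : continuous f by exact: cl.
    have cg : continuous g.
      by move=> t; exact: (continuousB (continuousM (cf t) (cf t)) (cl _ _ t)).
    have := @connected_component_path R _ S _ (@continuous_frame_path f g c b a
      cf cg).
    have -> : (c + f 0 *: b + g 0 *: a) *m F = 0.
      by rewrite [RHS]E0 /g /f !mul0r !addr0 -expr2 subKr.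
    have -> : (c + f 1 *: b + g 1 *: a) *m F = (c + e *: b) *m F.
      have f1 : f 1 = e by rewrite /f; ring.
      have g1 : g 1 = 0 by rewrite /g f1 -expr2 e1; ring.
      by rewrite f1 g1 scale0r addr0.
    apply=> t /andP[t0 t1]; apply: inS; first exact: submxMl.
    rewrite phi_param mulf_neq0 ?gt_eqF // /g expr2 subKr.
    have [->|tn1] := eqVneq t 1; first by rewrite mul1r addrC subrK.
    have tl1 : t < 1 by rewrite lt_neqAle tn1.
    have ? : 0 < (1 - t) * (s ^+ 2 - u) by rewrite mulr_gt0 // subr_gt0.
    lra.
  have c1 := comp 1 (expr1n _ _).
  have c2 : connected_component S 0 ((c + -1 *: b) *m F).
    by apply: comp; rewrite sqrrN expr1n.
  have h0 : 0 <= 2^-1 :> R by rewrite invr_ge0.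
  have h1 : 2^-1 <= 1 :> R by rewrite invf_le1 ?ler1n.
  pose half : {i01 R} := Itv01 h0 h1.
  have /set_mem/connected_component_sub[_] := conv _ _ half (mem_set c1)
    (mem_set c2).
  apply; exists 0; rewrite //= expr0n /= !scale0r !addr0.
  rewrite [RHS](_ : _ = 2^-1 *: ((c + 1 *: b) *m F) + (1 - 2^-1) *: ((c +
    -1 *: b) *m F)) //.
  rewrite !scalemxAl -mulmxDl; congr (_ *m F).
  by apply/rowP => j; rewrite !mxE; field.
split; first by apply: inS => //; rewrite lt_eqF.
have sub := connected_component_lt cphi neS lt0.
move=> x y l /set_mem cx /set_mem cy; apply/mem_set.
have [Px _] := connected_component_sub cx.
have [Py _] := connected_component_sub cy.
have px : phi x < 0 := sub x cx; have py : phi y < 0 := sub y cy.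
apply: (connected_component_trans cx).
have l0 : 0 <= l%:num by exact: ge0.
have l1 : l%:num <= 1 by exact: le1.
have [/(rowspanP F)[X xE] /(rowspanP F)[Y yE]] := (Px, Py).
(* As [x] is already in the component, the segment from [x] to the convex combination is enough; the
   zero summand fits the shape of [continuous_frame_path]. *)
pose gamma (t : R) := (X + t *: ((1 - l%:num) *: (Y - X)) + 0 *: 0) *m F.
have cg : continuous gamma.
  by apply: continuous_frame_path => t; [exact: cvg_id | exact: cst_continuous].
have := @connected_component_path R _ S _ cg.
have -> : gamma 0 = x by rewrite /gamma !scale0r !addr0.
have -> : gamma 1 = convex.conv l x y.
  rewrite [RHS](_ : _ = l%:num *: x + (1 - l%:num) *: y) // xE yE.
  rewrite /gamma !scalemxAl -mulmxDl; congr (_ *m F).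
  by apply/rowP => j; rewrite !mxE; ring.
apply=> t /andP[t0 t1]; apply: inS; first exact: submxMl.
rewrite lt_eqF //; pose r := t * (1 - l%:num).
have r0 : 0 <= r by rewrite mulr_ge0 // subr_ge0.
have r1 : r <= 1 by rewrite mulr_ile1 ?subr_ge0 // gerBl.
(* [phi] is convex along chords, its quadratic part being a square. *)
have -> : phi (gamma t) = (1 - r) * phi x + r * phi y -
    r * (1 - r) * (wedge a (X - c) - wedge a (Y - c)) ^+ 2.
  by rewrite /phi xE yE /gamma !(frameK FF) /r /wedge !mxE; ring.
have ? : 0 <= r * (1 - r) * (wedge a (X - c) - wedge a (Y - c)) ^+ 2.
  by apply: mulr_ge0; [apply: mulr_ge0; rewrite // subr_ge0 | exact: sqr_ge0].
by have [xy|xy] := leP (phi x) (phi y); nra.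
Qed.

Lemma on_emb_parabola : D 0 <-> wedge a c ^+ 2 = w * wedge b c.
Proof.
rewrite mem_emb_parabola; last exact: sub0mx.
have -> : phi 0 = wedge a c ^+ 2 - w * wedge b c.
  by rewrite /phi mul0mx /wedge !mxE; ring.
by split=> [/eqP|->]; rewrite ?subrr // subr_eq0 => /eqP.
Qed.

Lemma outside_emb_parabola :
  outside_parabola (rowspan F) D 0 <-> w * wedge b c < wedge a c ^+ 2.
Proof.
split=> [[_ /on_emb_parabola/eqP nD /inside_emb_parabola/negP]|gt0].
  by rewrite -leNgt le_eqVlt eq_sym (negPf nD).
split; first exact: sub0mx.
  by move=> /on_emb_parabola e; rewrite e ltxx in gt0.
by move=> /inside_emb_parabola lt0; have := lt_trans gt0 lt0; rewrite ltxx.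
Qed.

End Parabola.
End Sides.

(** * The ellipse and the parabola of a quadratic form *)

Section EllipseOfForm.
Variables (R : realType) (n : nat) (F : 'M[R]_(2, n.+1)).
Hypothesis FF : F *m F^T = 1%:M.
Variables A B C : 'rV[R]_2.
Local Notation c := (2^-1 *: (A + C)).
Local Notation a := (2^-1 *: (A - C)).
Local Notation D := (emb_ellipse F c a B).

Let wab : wedge a B = (wedge A B + wedge B C) / 2.
Proof. by rewrite /wedge !mxE; field. Qed.

Let wbc : wedge B c = (wedge B C - wedge A B) / 2.
Proof. by rewrite /wedge !mxE; field. Qed.

Let wac : wedge a c = wedge A C / 2.
Proof. by rewrite /wedge !mxE; field. Qed.

Lemma form_is_ellipse : is_ellipse D <-> wedge A B + wedge B C <> 0.
Proof.
rewrite (is_ellipse_embE FF) wab; split=> [/eqP ne e|ne].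
  by apply: ne; rewrite e mul0r.
by apply/eqP; lra.
Qed.

Let wab0 : wedge A B + wedge B C <> 0 -> wedge a B != 0.
Proof. by move=> ne; rewrite wab; apply/eqP; lra. Qed.

Lemma form_inside_ellipse : wedge A B + wedge B C <> 0 ->
  inside_ellipse (rowspan F) D 0 <->
  wedge A C ^+ 2 < 4 * wedge A B * wedge B C.
Proof.
move=> /wab0 w0; rewrite (inside_emb_ellipse FF c w0) wab wbc wac.
by rewrite -subr_lt0 -[in X in _ <-> X]subr_lt0; split; nra.
Qed.

Lemma form_on_ellipse : wedge A B + wedge B C <> 0 ->
  D 0 <-> wedge A C ^+ 2 = 4 * wedge A B * wedge B C.
Proof.
move=> /wab0 w0; rewrite (on_emb_ellipse FF c w0) wab wbc wac.
by split; nra.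
Qed.

Lemma form_outside_ellipse : wedge A B + wedge B C <> 0 ->
  outside_ellipse (rowspan F) D 0 <->
  4 * wedge A B * wedge B C < wedge A C ^+ 2.
Proof.
move=> /wab0 w0; rewrite (outside_emb_ellipse FF c w0) wab wbc wac.
by split; nra.
Qed.

Let a0E : a = 0 <-> A = C.
Proof.
split=> [/eqP|eAC]; last by rewrite eAC subrr scaler0.
by rewrite scaler_eq0 invr_eq0 pnatr_eq0 /= subr_eq0 => /eqP.
Qed.

Let not_point : is_segment D -> (a != 0) || (B != 0).
Proof.
apply: contraPT; rewrite negb_or !negbK => /andP[/eqP a0 /eqP b0].
rewrite a0 b0 emb_ellipse_set1; exact: segment_not_set1.
Qed.

Let segment_wab : is_segment D -> wedge a B = 0.
Proof.
move=> /segment_collinear col; apply/eqP; apply: contraPT col => w0.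
exact/ellipse_not_collinear/is_ellipse_emb.
Qed.

(** The line misses the origin unless [beta] and [gamma - alpha] both vanish, and when
    [alpha + gamma = 0] the latter vanishes only with [alpha]. The right-hand side also rules out
    [A = C], [B = 0], where the curve is a point. *)
Lemma form_segment_avoids : (is_segment D /\ line_avoids D 0) <->
  (wedge A B + wedge B C = 0 /\ (wedge A C <> 0 \/ wedge A B <> 0)).
Proof.
split=> [[seg]|[w0 ne]].
  have w0 := segment_wab seg.
  have [d [_ _ _ -> ->]] := emb_ellipse_segment FF c w0 (not_point seg).
  rewrite wab wac wbc in w0 * => ne; split; first lra.
  by apply: contrapT => /not_orP[/contrapT e1 /contrapT e2]; apply: ne; lra.
have w0' : wedge a B = 0 by rewrite wab w0 mul0r.
have ab : (a != 0) || (B != 0).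
  apply/negP => /negP; rewrite negb_or !negbK => /andP[/eqP/a0E eAC /eqP B0].
  by case: ne; rewrite ?eAC ?B0 /wedge ?mxE; apply; ring.
have [d [_ seg _ av wd]] := emb_ellipse_segment FF c w0' ab.
split=> //; apply/av => /wd; rewrite wac wbc => -[e1 e2].
by case: ne; apply; lra.
Qed.

Lemma form_segment_contains : (is_segment D /\ line_contains D 0) <->
  [/\ A <> C \/ B <> 0, wedge A B = 0, wedge A C = 0 & wedge B C = 0].
Proof.
split=> [[seg]|[ab e1 e2 e3]].
  have w0 := segment_wab seg; have np := not_point seg.
  have [d [_ _ -> _ ->]] := emb_ellipse_segment FF c w0 np.
  rewrite wab wac wbc in w0 * => -[e1 e2]; split; [|lra..].
  by case/orP: np => /eqP ne; [left=> /a0E|right].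
have w0' : wedge a B = 0 by rewrite wab e1 e3; lra.
have ab' : (a != 0) || (B != 0).
  by case: ab => /eqP ab; apply/orP; [left; apply/eqP => /a0E/eqP;
    apply/negP|right].
have [d [_ seg con _ wd]] := emb_ellipse_segment FF c w0' ab'.
by split=> //; apply/con/wd; rewrite wac wbc e1 e2 e3; split; lra.
Qed.

Lemma form_ellipse_point z : D = [set z] <-> [/\ A = C, B = 0 & z = A *m F].
Proof.
have cA : A = C -> c = A by move=> eAC; apply/rowP => j; rewrite !mxE eAC;
  field.
split=> [/(emb_ellipse_point FF)[/a0E eAC B0 zc]|[eAC B0 ->]].
  by split=> //; rewrite zc cA.
by rewrite (a0E.2 eAC) B0 emb_ellipse_set1 cA.
Qed.

End EllipseOfForm.

Section ParabolaOfForm.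
Variables (R : realType) (n : nat) (F : 'M[R]_(2, n.+1)).
Hypothesis FF : F *m F^T = 1%:M.
Variables A B C : 'rV[R]_2.
Local Notation D := (emb_parabola F C (2 *: B) A).

Let wab : wedge A (2 *: B) = 2 * wedge A B.
Proof. by rewrite /wedge !mxE; ring. Qed.

Let wbc : wedge (2 *: B) C = 2 * wedge B C.
Proof. by rewrite /wedge !mxE; ring. Qed.

Let wab0 : wedge A B <> 0 -> wedge A (2 *: B) != 0.
Proof. by move=> ne; rewrite wab; apply/eqP; lra. Qed.

Lemma form_is_parabola : is_parabola D <-> wedge A B <> 0.
Proof.
rewrite (is_parabola_embE FF); split=> [/eqP ne e|/wab0 //].
by apply: ne; rewrite wab e mulr0.
Qed.

Lemma form_inside_parabola : wedge A B <> 0 ->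
  inside_parabola (rowspan F) D 0 <->
  wedge A C ^+ 2 < 4 * wedge A B * wedge B C.
Proof.
move=> /wab0 w0; rewrite (inside_emb_parabola FF C w0) wab wbc.
by rewrite (_ : _ * (2 * _) = 4 * wedge A B * wedge B C) //; ring.
Qed.

Lemma form_on_parabola : wedge A B <> 0 ->
  D 0 <-> wedge A C ^+ 2 = 4 * wedge A B * wedge B C.
Proof.
move=> /wab0 w0; rewrite (on_emb_parabola FF C w0) wab wbc.
by rewrite (_ : _ * (2 * _) = 4 * wedge A B * wedge B C) //; ring.
Qed.

Lemma form_outside_parabola : wedge A B <> 0 ->
  outside_parabola (rowspan F) D 0 <->
  4 * wedge A B * wedge B C < wedge A C ^+ 2.
Proof.
move=> /wab0 w0; rewrite (outside_emb_parabola FF C w0) wab wbc.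
by rewrite (_ : _ * (2 * _) = 4 * wedge A B * wedge B C) //; ring.
Qed.

Let collinear_wedge : collinear D -> wedge A B = 0.
Proof.
move=> col; apply: contrapT => /form_is_parabola.
by move=> /parabola_not_collinear; apply.
Qed.

Let b0E : 2 *: B = 0 <-> B = 0.
Proof.
split=> [/eqP|->]; last by rewrite scaler0.
by rewrite scaler_eq0 pnatr_eq0 => /eqP.
Qed.

(** A collinear curve with nonzero quadratic coefficient folds into a half-line, so a line forces
    [A = 0]. *)
Lemma form_is_line : is_line D <-> A = 0 /\ B <> 0.
Proof.
split=> [lD|[A0 /eqP B0]]; last first.
  rewrite A0; apply: (emb_parabola_isline FF).
  by apply: contra_neq B0 => /b0E.
have w0 := collinear_wedge (line_collinear lD).
have A0 : A = 0.
  apply/eqP; apply: contraPT lD => A0; apply: halfline_not_line.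
  have w0' : wedge A (2 *: B) = 0 by rewrite wab w0 mulr0.
  by have [] := emb_parabola_ishalfline FF C A0 w0'.
split=> // B0; move: lD; rewrite A0 B0 scaler0 emb_parabola_set1.
exact: line_not_set1.
Qed.

Lemma form_line_origin : A = 0 -> B <> 0 -> D 0 <-> wedge B C = 0.
Proof.
move=> A0 /eqP B0; rewrite A0 -(origin_on_line FF C B0).
split=> [[t _ e]|[t e]].
  exists (2 * t); rewrite -e scalemxAl -mulmxDl; congr (_ *m F).
  by apply/rowP => j; rewrite !mxE; ring.
exists (t / 2) => //; rewrite -e scalemxAl -mulmxDl; congr (_ *m F).
by apply/rowP => j; rewrite !mxE; field.
Qed.

Let halfline_nonzero : is_halfline D -> A <> 0 /\ wedge A B = 0.
Proof.
move=> hD; split; last exact/collinear_wedge/halfline_collinear.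
move=> A0; have [B0|B0] := eqVneq B 0.
  move: hD; rewrite A0 B0 scaler0 emb_parabola_set1.
  exact: halfline_not_set1.
by apply: (halfline_not_line hD); apply/form_is_line; split=> //; apply/eqP.
Qed.

Let halflineP : A <> 0 -> wedge A B = 0 ->
  [/\ is_halfline D, line_contains D 0 <-> wedge A C = 0 &
    line_avoids D 0 <-> wedge A C <> 0].
Proof.
move=> /eqP A0 w0; apply: (emb_parabola_ishalfline FF C A0).
by rewrite wab w0 mulr0.
Qed.

Lemma form_halfline_avoids : (is_halfline D /\ line_avoids D 0) <->
  (wedge A B = 0 /\ wedge A C <> 0).
Proof.
split=> [[hD]|[w0 ne]].
  have [A0 w0] := halfline_nonzero hD.
  by have [_ _ ->] := halflineP A0 w0.
have A0 : A <> 0 by move=> A0; apply: ne; rewrite A0 wedge0l.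
by have [hD _ ->] := halflineP A0 w0.
Qed.

Lemma form_halfline_contains : (is_halfline D /\ line_contains D 0) <->
  [/\ A <> 0, wedge A B = 0 & wedge A C = 0].
Proof.
split=> [[hD]|[A0 w0]].
  have [A0 w0] := halfline_nonzero hD.
  by have [_ -> _] := halflineP A0 w0.
by have [hD -> _] := halflineP A0 w0.
Qed.

Lemma form_parabola_point z : D = [set z] <-> [/\ A = 0, B = 0 & z = C *m F].
Proof.
split=> [/(emb_parabola_point FF)[A0 /b0E B0 zc] //|[A0 B0 ->]].
by rewrite A0 B0 scaler0 emb_parabola_set1.
Qed.

End ParabolaOfForm.

(** * Comparison of the two curves through [alpha], [beta], [gamma] *)

Section Classification.
Variables (R : realType) (n m : nat).
Variables (F : 'M[R]_(2, n.+1)) (G : 'M[R]_(2, m.+1)).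
Hypotheses (FF : F *m F^T = 1%:M) (GG : G *m G^T = 1%:M).
Variables A B C : 'rV[R]_2.
Local Notation alpha := (wedge A B).
Local Notation beta := (wedge A C).
Local Notation gamma := (wedge B C).

(** The linear relation between three plane vectors. When [alpha = beta = 0] it reads [gamma A = 0],
    which separates the line from the half-line. *)
Let wedge_syzygy : gamma *: A = beta *: B - alpha *: C.
Proof. by apply/rV2P; rewrite /wedge !mxE; ring. Qed.

Let A0_of_gamma : alpha = 0 -> beta = 0 -> gamma <> 0 -> A = 0.
Proof.
move=> a0 b0 /eqP g0; move: wedge_syzygy; rewrite a0 b0 !scale0r subrr => /eqP.
by rewrite scaler_eq0 (negPf g0) => /eqP.
Qed.

Let gamma0_of_A : alpha = 0 -> beta = 0 -> A <> 0 -> gamma = 0.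
Proof. by move=> a0 b0 A0; apply: contrapT => /(A0_of_gamma a0 b0). Qed.

Let A0_alpha : A = 0 -> alpha = 0 /\ beta = 0.
Proof. by move=> ->; rewrite !wedge0l. Qed.

Let B0_gamma : B = 0 -> gamma = 0.
Proof. by move=> ->; rewrite wedge0l. Qed.

Lemma classification (asym : Prop) : (asym <-> alpha = 0) ->
  let De := emb_ellipse F (2^-1 *: (A + C)) (2^-1 *: (A - C)) B in
  let Dp := emb_parabola G C (2 *: B) A in
  let Pe := rowspan F in
  let Pp := rowspan G in
  [/\ (is_ellipse De /\ inside_ellipse Pe De 0) <->
      (is_parabola Dp /\ inside_parabola Pp Dp 0),
      let lhs := (is_ellipse De /\ outside_ellipse Pe De 0) \/
                 (is_segment De /\ line_avoids De 0) in
      let parab := is_parabola Dp /\ outside_parabola Pp Dp 0 in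
      let halfl := is_halfline Dp /\ line_avoids Dp 0 in
      [/\ lhs <-> parab \/ halfl,
          lhs -> (parab <-> ~ asym) & lhs -> (halfl <-> asym)],
      let lhs := is_ellipse De /\ De 0 in
      let parab := is_parabola Dp /\ Dp 0 in
      let line := is_line Dp /\ ~ Dp 0 in
      [/\ lhs <-> parab \/ line,
          lhs -> (parab <-> ~ asym) & lhs -> (line <-> asym)],
      ((is_segment De /\ line_contains De 0) \/
       (exists2 z, z != 0 & De = [set z])) <->
      [\/ is_line Dp /\ Dp 0,
          is_halfline Dp /\ line_contains Dp 0 |
          exists2 z, z != 0 & Dp = [set z]] &
      De = [set 0] <-> Dp = [set 0]].
Proof.
move=> asymE De Dp Pe Pp.
have and_iff (P Q S : Prop) : (P -> (Q <-> S)) -> (P /\ Q <-> P /\ S).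
  by move=> H; split=> -[p q]; split=> //; apply/(H p).
have e_in : is_ellipse De /\ inside_ellipse Pe De 0 <->
    beta ^+ 2 < 4 * alpha * gamma.
  rewrite (form_is_ellipse FF) (and_iff _ _ _ (@form_inside_ellipse _ _ _ FF A
    B C)).
  (* The inequality forces an ellipse: if [alpha + gamma = 0], then [4 alpha gamma = - 4 alpha ^+ 2]
     cannot exceed a square. *)
  by split=> [[]//|lt0]; split=> // e; nra.
have p_in : is_parabola Dp /\ inside_parabola Pp Dp 0 <->
    beta ^+ 2 < 4 * alpha * gamma.
  rewrite (form_is_parabola GG) (and_iff _ _ _ (@form_inside_parabola _ _ _ GG
    A B C)).
  by split=> [[]//|lt0]; split=> // e; nra.
(* When [alpha + gamma = 0] the discriminant is [beta ^+ 2 + 4 alpha ^+ 2], positive exactly when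
   the segment condition holds; this is why ellipse and segment share a clause. *)
have e_out : (is_ellipse De /\ outside_ellipse Pe De 0) \/
    (is_segment De /\ line_avoids De 0) <-> 4 * alpha * gamma < beta ^+ 2.
  rewrite (form_segment_avoids FF) (form_is_ellipse FF).
  rewrite (and_iff _ _ _ (@form_outside_ellipse _ _ _ FF A B C)).
  split=> [[[]//|[e [ne|ne]]]|lt0].
  - by have : 0 < beta ^+ 2; [rewrite lt_neqAle sqr_ge0 eq_sym expf_neq0 //;
    exact/eqP | nra].
  - have : 0 < alpha ^+ 2; [rewrite lt_neqAle sqr_ge0 eq_sym expf_neq0 //;
    exact/eqP|].
    by have ? := sqr_ge0 beta; nra.
  have [e|] := pselect (alpha + gamma = 0); last by left.
  right; split=> //; apply: contrapT => /not_orP[/contrapT b0 /contrapT a0].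
  by rewrite a0 b0 in lt0; lra.
have p_out : is_parabola Dp /\ outside_parabola Pp Dp 0 <->
    alpha <> 0 /\ 4 * alpha * gamma < beta ^+ 2.
  by rewrite (form_is_parabola GG) (and_iff _ _ _ (@form_outside_parabola _ _ _
    GG A B C)).
have h_out := form_halfline_avoids GG A B C.
have h_out' : alpha = 0 -> (beta <> 0 <-> 4 * alpha * gamma < beta ^+ 2).
  move=> ->; rewrite mulr0 mul0r lt_neqAle sqr_ge0 andbT eq_sym expf_eq0 /=.
  by split=> [/eqP|/eqP].
have e_on : is_ellipse De /\ De 0 <->
    alpha + gamma <> 0 /\ beta ^+ 2 = 4 * alpha * gamma.
  by rewrite (form_is_ellipse FF) (and_iff _ _ _ (@form_on_ellipse _ _ _ FF A B
    C)).
have p_on : is_parabola Dp /\ Dp 0 <->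
    alpha <> 0 /\ beta ^+ 2 = 4 * alpha * gamma.
  by rewrite (form_is_parabola GG) (and_iff _ _ _ (@form_on_parabola _ _ _ GG A
    B C)).
(* With [alpha = 0] a zero discriminant gives [beta = 0], and then [gamma <> 0] forces [A = 0] by
   the syzygy. *)
have l_off : is_line Dp /\ ~ Dp 0 <->
    [/\ alpha = 0, gamma <> 0 & beta ^+ 2 = 4 * alpha * gamma].
  rewrite (form_is_line GG); split=> [[[A0 B0] nD]|[a0 g0]].
    have [a0 b0] := A0_alpha A0.
    by split=> // [/(form_line_origin GG C A0 B0)|]; rewrite // a0 b0; ring.
  rewrite a0 mulr0 mul0r => /eqP; rewrite expf_eq0 => /= /eqP b0.
  have A0 := A0_of_gamma a0 b0 g0; have B0 : B <> 0 by move=> /B0_gamma.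
  by split=> // /(form_line_origin GG C A0 B0).
have l_on : is_line Dp /\ Dp 0 <-> [/\ A = 0, B <> 0 & gamma = 0].
  rewrite (form_is_line GG); split=> [[[A0 B0]]|[A0 B0 g0]].
    by move/(form_line_origin GG C A0 B0).
  by split=> //; apply/(form_line_origin GG C A0 B0).
have s_on := form_segment_contains FF A B C.
have h_on := form_halfline_contains GG A B C.
have e_pt z := form_ellipse_point FF A B C z.
have p_pt z := form_parabola_point GG A B C z.
have a_pos : alpha ^+ 2 = 0 -> alpha = 0.
  by move=> /eqP; rewrite expf_eq0 => /= /eqP.
split.
- by rewrite e_in p_in.
- move=> lhs parab halfl; rewrite /lhs /parab /halfl.
  split; rewrite e_out ?p_out ?h_out ?asymE.
  + split=> [lt0|[[]//|[a0 b0]]]; last exact/(h_out' a0).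
    have [a0|a0] := pselect (alpha = 0); last by left.
    by right; split=> //; apply/(h_out' a0).
  + by move=> lt0; split=> [[]|].
  + by move=> lt0; split=> [[]//|a0]; split=> //; apply/(h_out' a0).
- move=> lhs parab line; rewrite /lhs /parab /line.
  split; rewrite e_on ?p_on ?l_off ?asymE.
  + split=> [[s0 e]|[[a0 e]|[a0 g0 e]]].
    * have [a0|a0] := pselect (alpha = 0); last by left.
      by right; split=> // g0; apply: s0; lra.
    * split=> // s0; apply/a0/a_pos; have := sqr_ge0 beta;
      have := sqr_ge0 alpha.
      nra.
    * by split=> // s0; apply: g0; lra.
  + by move=> [_ e]; split=> [[]|].
  + by move=> [s0 e]; split=> [[]//|a0]; split=> // g0; apply: s0; lra.
(* On both sides all three determinants vanish. The parabola is a half-line if [A <> 0], a line if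
   only [A] vanishes among [A], [B], and the point [C] if both vanish; the ellipse is a point
   exactly when [A = C] and [B = 0]. *)
- split.
  + case=> [/s_on[ne a0 b0 g0]|[z z0 /e_pt[eAC B0 zA]]].
      have [A0|A0] := pselect (A = 0); last by constructor 2; apply/h_on.
      have [B0|B0] := pselect (B = 0); last by constructor 1; apply/l_on.
      constructor 3; exists (C *m G); last exact/p_pt.
      rewrite (frame_eq0 GG); apply/eqP => C0.
      by case: ne; apply; rewrite ?A0 ?C0 ?B0.
    have A0 : A <> 0.
      by move=> A0; move: z0; rewrite zA A0 mul0mx eqxx.
    by constructor 2; apply/h_on; rewrite -eAC B0 wedge0r /wedge; split=> //;
      ring.
  + case=> [/l_on[A0 B0 g0]|/h_on[A0 a0 b0]|[z z0 /p_pt[A0 B0 zC]]].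
    * have [a0 b0] := A0_alpha A0.
      by left; apply/s_on; split=> //; right.
    * have g0 := gamma0_of_A a0 b0 A0.
      have [eAC|eAC] := pselect (A = C); last by left; apply/s_on; split=> //;
        left.
      have [B0|B0] := pselect (B = 0); last by left; apply/s_on; split=> //;
        right.
      right; exists (A *m F); last exact/e_pt.
      by rewrite (frame_eq0 FF); exact/eqP.
    * left; apply/s_on; rewrite A0 B0 !wedge0l; split=> //; left=> C0.
      by move: z0; rewrite zC -C0 mul0mx eqxx.
- rewrite e_pt p_pt; split=> [[eAC B0 /esym/eqP]|[A0 B0 /esym/eqP]].
    rewrite (frame_eq0 FF) => /eqP A0.
    by split=> //; rewrite -eAC A0 mul0mx.
  rewrite (frame_eq0 GG) => /eqP C0.
  by split=> //; rewrite ?C0 // A0 mul0mx.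
Qed.

End Classification.

Lemma row_free_wedge (R : realType) n (F : 'M[R]_(2, n.+1)) (x y : 'rV[R]_2) :
  F *m F^T = 1%:M ->
  row_free (col_mx (x *m F) (y *m F)) = (wedge x y != 0).
Proof.
move=> FF; rewrite -mul_col_mx /row_free mxrankMfree; last first.
  by apply/row_freeP; exists F^T.
apply/idP/idP => [rf|w0].
  apply/eqP => /wedge0_common[d [k [l [_ xE yE]]]]; move: rf.
  (* Factoring through the single row [d] bounds the rank by 1. *)
  have -> : col_mx x y = col_mx k%:M l%:M *m d.
    by rewrite mul_col_mx !mul_scalar_mx -xE -yE.
  by move=> /eqP rk; have := mxrankM_maxr (col_mx k%:M l%:M) d;
    rewrite rk => /leq_trans/(_ (rank_leq_row d)).
rewrite -/(row_free _); apply: inj_row_free => u.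
rewrite -[u]hsubmxK mul_row_col => e.
have e2 : lsubmx u 0 0 *: x + rsubmx u 0 0 *: y = 0.
  by rewrite -!mul_scalar_mx -!mx11_scalar.
have wl : wedge (lsubmx u 0 0 *: x + rsubmx u 0 0 *: y) y =
  lsubmx u 0 0 * wedge x y.
  by move: (lsubmx u 0 0) (rsubmx u 0 0) => k l; rewrite /wedge !mxE; ring.
have wr : wedge x (lsubmx u 0 0 *: x + rsubmx u 0 0 *: y) =
  rsubmx u 0 0 * wedge x y.
  by move: (lsubmx u 0 0) (rsubmx u 0 0) => k l; rewrite /wedge !mxE; ring.
move/esym/eqP: wl; rewrite e2 wedge0l mulf_eq0 (negPf w0) orbF => /eqP l0.
move/esym/eqP: wr; rewrite e2 wedge0r mulf_eq0 (negPf w0) orbF => /eqP r0.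
by rewrite (mx11_scalar (lsubmx u)) (mx11_scalar (rsubmx u)) l0 r0 !raddf0
  row_mx0.
Qed.

Lemma derive1_trig_form (R : realType) n (x y z : 'rV[R]_n.+1) (t : R) :
  derive1 (fun s : R => cos s ^+ 2 *: x + (2 * (cos s * sin s)) *: y +
    sin s ^+ 2 *: z) t =
  (- (2 * (cos t * sin t))) *: x + (2 * (cos t ^+ 2 - sin t ^+ 2)) *: y +
  (2 * (cos t * sin t)) *: z.
Proof.
pose h (a b c s : R) := cos s ^+ 2 * a + 2 * (cos s * sin s) * b +
  sin s ^+ 2 * c.
have dh a b c : is_derive t 1 (h a b c) (- (2 * (cos t * sin t)) * a +
    (2 * (cos t ^+ 2 - sin t ^+ 2)) * b + (2 * (cos t * sin t)) * c).
  have dc := is_derive_cos t; have ds := is_derive_sin t.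
  have -> : h a b c = (fun s => a) * (cos * cos)
      + (fun s => 2 * b) * (cos * sin) + (fun s => c) * (sin * sin).
    by apply/funext => s; rewrite /h !fctE; ring.
  have D := is_deriveD (is_deriveD
    (is_deriveM (is_derive_cst a t 1) (is_deriveM dc dc))
    (is_deriveM (is_derive_cst (2 * b) t 1) (is_deriveM dc ds)))
    (is_deriveM (is_derive_cst c t 1) (is_deriveM ds ds)).
  apply: (is_derive_eq D).
  rewrite /GRing.scale /= !fctE.
  ring.
set f := fun s => _.
have fE i j : (fun s => f s i j) = h (x 0 j) (y 0 j) (z 0 j).
  by apply/funext => s; rewrite /f /h !mxE (ord1 i).
have df : derivable f t 1.
  by apply/derivable_mxP => i j; rewrite fE; case: (dh (x 0 j) (y 0 j) (z 0 j)).
rewrite derive1E derive_mx //; apply/rowP => j; rewrite mxE fE.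
by rewrite (@derive_val _ _ _ _ _ _ _ (dh (x 0 j) (y 0 j) (z 0 j))) !mxE.
Qed.

(** * Orthonormal frames *)

(** The stacked frame is a square matrix [Q] with [Q Q^T = 1], hence [Q^T Q = 1]. The result splits
    any vector into its two orthogonal parts. *)
Lemma orthonormal_completion (R : realType) m k (E : 'M[R]_(m, m + k))
    (F : 'M[R]_(k, m + k)) :
  E *m E^T = 1%:M -> F *m F^T = 1%:M -> E *m F^T = 0 ->
  E^T *m E + F^T *m F = 1%:M.
Proof.
move=> EE FF EF.
have FE : F *m E^T = 0 by rewrite -[F]trmxK -trmx_mul EF trmx0.
rewrite -mul_row_col -tr_col_mx; apply: mulmx1C.
by rewrite tr_col_mx mul_col_row EE FF EF FE -scalar_mx_block.
Qed.

Lemma orthE (R : realType) k n p (V : 'M[R]_(k, n)) (W : 'M[R]_(p, n)) :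
  (W <= orth V)%MS = (W *m V^T == 0).
Proof. exact: sub_kermx. Qed.

Lemma orth_disjoint (R : realType) k n (V : 'M[R]_(k, n)) :
  (orth V :&: <<V>>)%MS = 0.
Proof.
apply/eqP; rewrite -submx0; apply/rV_subP => x.
rewrite sub_capmx orthE genmxE => /andP[/eqP xV /submxP[k' xE]].
rewrite submx0 -dot_eq0 /dot {2}xE trmx_mul mulmxA xV mul0mx mxE //.
Qed.

Lemma orth_projection (R : realType) k n p (V : 'M[R]_(k, n)) (x y : 'M[R]_(p,
  n)) :
  (x <= V)%MS -> y *m V^T = 0 ->
  (x + y) *m proj_mx (orth V) <<V>>%MS = y.
Proof.
move=> xV /eqP yV; rewrite mulmxDl (proj_mx_0 (orth_disjoint V)) ?genmxE //.
by rewrite (proj_mx_id (orth_disjoint V)) ?orthE // add0r.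
Qed.

Section Frames.
Variable R : realType.
Variables (J E F : 'M[R]_(2, 4)) (B : 'M[R]_(3, 4)) (v : 'rV[R]_4).
Hypotheses (free_J : row_free J) (tangent_v : (v <= J)%MS) (unit_v : dot v v =
  1).
Hypotheses (basisE : orthonormal_basis_of E J).
Hypotheses (basisF : orthonormal_basis_of F (orth J)).
Hypotheses (basisB : orthonormal_basis_of B (orth v)).

(** The rows of [K] are the coordinates of [e_1], [e_2] in the basis of partial derivatives. [Jg] is
    the Jacobian of the projected map and [G] the projected normal frame, both in the coordinates
    given by [B]. *)
Local Notation K := (E *m pinvmx J).
Local Notation G := (F *m B^T).
Local Notation Jg := (J *m B^T).

Let EE : E *m E^T = 1%:M. Proof. by case: basisE. Qed.
Let FF : F *m F^T = 1%:M. Proof. by case: basisF. Qed.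
Let BB : B *m B^T = 1%:M. Proof. by case: basisB. Qed.
Let E_J : (E == J)%MS. Proof. by case: basisE. Qed.

Let KJ : K *m J = E.
Proof. by rewrite mulmxKpV //; case/andP: E_J. Qed.

Let FJ : F *m J^T = 0.
Proof. by apply/eqP; rewrite -orthE; case: basisF => _ /andP[]. Qed.

Let FE : F *m E^T = 0.
Proof. by rewrite -KJ trmx_mul mulmxA FJ mul0mx. Qed.

Let EF : E *m F^T = 0.
Proof. by rewrite -[E]trmxK -trmx_mul FE trmx0. Qed.

Let EF1 : E^T *m E + F^T *m F = 1%:M.
Proof. exact: (@orthonormal_completion _ 2 2). Qed.

Lemma tangent_vectorE : v *m E^T *m E = v.
Proof.
have /submxP[k ->] : (v <= E)%MS.
  by case/andP: E_J => _ /(submx_trans tangent_v).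
by rewrite -!mulmxA (mulmxA E) EE mul1mx.
Qed.

Let Fv : F *m v^T = 0.
Proof. by rewrite -tangent_vectorE trmx_mul mulmxA FE mul0mx. Qed.

Let Bv : B *m v^T = 0.
Proof. by apply/eqP; rewrite -orthE; case: basisB => _ /andP[]. Qed.

Let vB : v *m B^T = 0.
Proof. by rewrite -[v]trmxK -trmx_mul Bv trmx0. Qed.

Let BB1 : B^T *m B = 1%:M - v^T *m v.
Proof.
have vv : v *m v^T = 1%:M by rewrite [LHS]mx11_scalar -/(dot v v) unit_v.
by rewrite -(@orthonormal_completion _ 1 3 v B vv BB vB) addrC addKr.
Qed.

(** Taking coordinates in [B] already kills [v], so the projected map is [X] followed by a constant
    matrix. *)
Lemma proj_along_frame z : proj_along v z *m B^T = z *m B^T.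
Proof. by rewrite /proj_along mulmxBl -scalemxAl vB scaler0 subr0. Qed.

(** [B^T *m B] is the projection along [v], and it fixes the rows of [F], which are orthogonal to
    the tangent vector [v]. *)
Lemma projected_frame : G *m G^T = 1%:M.
Proof.
rewrite trmx_mul trmxK -!mulmxA (mulmxA B^T) BB1 mulmxBl mul1mx mulmxBr FF.
by rewrite -mulmxA (mulmxA F) Fv mul0mx subr0.
Qed.

Let GJg : G *m Jg^T = 0.
Proof.
rewrite trmx_mul trmxK -!mulmxA (mulmxA B^T) BB1 mulmxBl mul1mx mulmxBr FJ.
by rewrite -mulmxA (mulmxA F) Fv mul0mx subr0.
Qed.

Let EB : E *m B^T = K *m Jg.
Proof. by rewrite mulmxA KJ. Qed.

(** The tangential part of [z] projects into the image of [Jg] and is removed; the normal part keeps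
    its coordinates, with [G] in place of [F]. *)
Lemma projected_normal (z : 'rV[R]_4) :
  (z *m B^T) *m proj_mx (orth Jg) <<Jg>>%MS = z *m F^T *m G.
Proof.
have -> : z *m B^T = z *m E^T *m (E *m B^T) + z *m F^T *m G.
  by rewrite !mulmxA -mulmxDl -!(mulmxA z) -mulmxDr EF1 mulmx1.
apply: orth_projection; first by rewrite EB mulmxA submxMl.
by rewrite -mulmxA GJg mulmx0.
Qed.

Lemma normal_rowspan : [set z | (z <= orth J)%MS] = rowspan F.
Proof.
apply/seteqP; split=> z; rewrite /rowspan /=.
  by case: basisF => _ /andP[_ s] zJ; exact: submx_trans zJ s.
by case: basisF => _ /andP[s _] zF; exact: submx_trans zF s.
Qed.

(** A normal vector of the projected surface, pulled back by [B], is orthogonal to the tangent plane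
    of the original one, hence lies in the span of [F]. *)
Lemma projected_normal_rowspan : [set z | (z <= orth Jg)%MS] = rowspan G.
Proof.
apply/seteqP; split=> z; rewrite /rowspan /= orthE.
  move=> /eqP zJ.
  have zE : z *m B *m E^T = 0.
    have := congr1 trmx EB; rewrite trmx_mul trmxK (trmx_mul K Jg) => BE.
    by rewrite -mulmxA BE mulmxA zJ mul0mx.
  have -> : z = z *m B *m F^T *m G; last exact: submxMl.
  rewrite -[LHS]mulmx1 -BB mulmxA -[z *m B in LHS]mulmx1 -EF1 mulmxDr !mulmxA.
  by rewrite zE mul0mx add0r.
by move=> /submxP[y ->]; rewrite -mulmxA GJg mulmx0.
Qed.

Lemma tangent_coord (Y : 'rV[R]_2) : Y *m J *m E^T *m K = Y.
Proof.
apply: (row_free_inj free_J); rewrite /= -(mulmxA (Y *m J *m E^T)) KJ.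
have /submxP[D JD] : (J <= E)%MS by case/andP: E_J.
by rewrite JD -!mulmxA (mulmxA E) EE mul1mx.
Qed.

(** Pythagoras: the projection removes the component along [v], whose coordinates in the frame [E]
    are [v *m E^T]. *)
Lemma projected_norm (w : 'rV[R]_2) : dot (w *m K *m Jg) (w *m K *m Jg) =
  dot w w - dot w (v *m E^T) ^+ 2.
Proof.
have -> : w *m K *m Jg = w *m E *m B^T by rewrite -(mulmxA w) -EB mulmxA.
have H : (w *m E *m B^T) *m (w *m E *m B^T)^T =
    w *m w^T - w *m (v *m E^T)^T *m (v *m E^T *m w^T).
  rewrite (trmx_mul (w *m E)) trmxK -(mulmxA (w *m E)) (mulmxA B^T) BB1.
  rewrite mulmxBl mulmxBr mul1mx !trmx_mul trmxK -!mulmxA.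
  by rewrite (mulmxA E E^T) EE mul1mx.
rewrite [LHS]/dot H -/(dot w w) mxE [X in _ + X]mxE [X in - X]mxE big_ord1.
rewrite -/(dot w w) -/(dot w (v *m E^T)) -/(dot (v *m E^T) w).
by rewrite (dotC (v *m E^T)) expr2.
Qed.

Lemma tangent_direction : dot (v *m E^T) (v *m E^T) = 1.
Proof.
by rewrite /dot trmx_mul trmxK mulmxA tangent_vectorE.
Qed.

End Frames.

Lemma unit_vecE (R : realType) (t : R) :
  unit_vec t 0 0 = cos t /\ unit_vec t 0 1 = sin t.
Proof. by rewrite !mxE. Qed.

(** * The second form in the orthonormal tangent basis starting with [v] *)

Section RotatedForm.
Variables (R : realType) (L M N nu : 'rV[R]_2).
Hypothesis nu1 : dot nu nu = 1.

(** The quarter turn: when [nu] holds the coordinates of [v], [rot2 nu] holds those of the vector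
    [v'] of the overview. *)
Definition rot2 (w : 'rV[R]_2) : 'rV[R]_2 := \row_j (if j == 0 then - w 0 1
  else w 0 0).

Local Notation q := (symform L M N).
Local Notation A := (q nu nu).
Local Notation B := (q nu (rot2 nu)).
Local Notation C := (q (rot2 nu) (rot2 nu)).

Let nu2 : nu 0 0 ^+ 2 + nu 0 1 ^+ 2 = 1.
Proof. by rewrite -nu1 dot2E !expr2. Qed.

Let rot0 w : rot2 w 0 0 = - w 0 1. Proof. by rewrite mxE. Qed.
Let rot1 w : rot2 w 0 1 = w 0 0. Proof. by rewrite mxE. Qed.

Lemma symform_rotated k l :
  q (k *: nu + l *: rot2 nu) (k *: nu + l *: rot2 nu) =
  k ^+ 2 *: A + (2 * (k * l)) *: B + l ^+ 2 *: C.
Proof. by apply/rowP => j; rewrite !mxE; ring. Qed.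

Lemma rotated_coord w : w = dot w nu *: nu + dot w (rot2 nu) *: rot2 nu.
Proof.
apply/rV2P; rewrite !mxE /= !dot2E rot0 rot1.
  by rewrite -[LHS]mulr1 -nu2; ring.
by rewrite -[LHS]mulr1 -nu2; ring.
Qed.

Lemma rotated_norm w : dot w w = dot w nu ^+ 2 + dot w (rot2 nu) ^+ 2.
Proof. by rewrite !dot2E rot0 rot1 -[LHS]mulr1 -nu2; ring. Qed.

(** A unit vector at angle [s] from [nu] gives the point of parameter [2 s] on the right, by the
    double angle formulas. *)
Lemma ellipse_of_form n (F : 'M[R]_(2, n.+1)) :
  (fun t => q (unit_vec t) (unit_vec t) *m F) @` `[0, 2 * pi] =
  emb_ellipse F (2^-1 *: (A + C)) (2^-1 *: (A - C)) B.
Proof.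
have half k l : k ^+ 2 + l ^+ 2 = 1 ->
    k ^+ 2 *: A + (2 * (k * l)) *: B + l ^+ 2 *: C =
    2^-1 *: (A + C) + (k ^+ 2 - l ^+ 2) *: (2^-1 *: (A - C)) +
      (2 * (k * l)) *: B.
  move=> kl; move: (A) (B) (C) => a b c; apply/rowP => j; rewrite !mxE.
  have -> : l ^+ 2 = 1 - k ^+ 2 by rewrite -kl; ring.
  by field.
have double (s : R) : cos (s + s) = cos s ^+ 2 - sin s ^+ 2 /\
    sin (s + s) = 2 * (cos s * sin s).
  by rewrite cosD sinD !expr2; split=> //; ring.
have unitn t : dot (unit_vec t) nu ^+ 2 + dot (unit_vec t) (rot2 nu) ^+ 2 =
  1 :> R.
  by rewrite -rotated_norm dot2E; have [-> ->] := unit_vecE t;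
    rewrite -!expr2 cos2Dsin2.
apply/seteqP; split=> [_ [t _ <-]|_ [t _ <-]].
  have [s [e0 e1]] := circle_angle (unitn t).
  exists (s + s) => //; have [-> ->] := double s.
  rewrite (rotated_coord (unit_vec t)) e0 e1 symform_rotated half //.
  exact: cos2Dsin2.
(* The parameter [t] on the right is any real number; its half determines a unit vector, whose own
   angle can be chosen in [[0, 2 * pi]]. *)
pose w := cos (t / 2) *: nu + sin (t / 2) *: rot2 nu.
have ww : w 0 0 ^+ 2 + w 0 1 ^+ 2 = 1.
  transitivity ((cos (t / 2) ^+ 2 + sin (t / 2) ^+ 2) * (nu 0 0 ^+ 2 +
    nu 0 1 ^+ 2)).
    by rewrite /w !mxE /=; ring.
  by rewrite cos2Dsin2 nu2 mulr1.
have [s s_in [w0 w1]] := circle_angle_2pi ww.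
exists s; first by rewrite /= in_itv.
have -> : unit_vec s = w.
  by have [u0 u1] := unit_vecE s; apply/rV2P; rewrite ?u0 ?u1.
have tE : t = t / 2 + t / 2 by field.
rewrite symform_rotated half ?cos2Dsin2 // [in RHS]tE.
by have [-> ->] := double (t / 2).
Qed.

(** The constraint says that the component [l] of [w] along [rot2 nu] is [1] or [-1]. Since the form
    is even, this sign is absorbed into the parameter [t = k l], where [k] is the component along
    [nu]. *)
Lemma parabola_of_form n (G : 'M[R]_(2, n.+1)) :
  (fun w => q w w *m G) @` [set w | dot w w - dot w nu ^+ 2 = 1] =
  emb_parabola G C (2 *: B) A.
Proof.
have E k l : l ^+ 2 = 1 -> q (k *: nu + l *: rot2 nu) (k *: nu + l *: rot2 nu) =
    C + (k * l) *: (2 *: B) + (k * l) ^+ 2 *: A.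
  move=> l1; rewrite symform_rotated exprMn l1.
  by move: (A) (B) (C) => a b c; apply/rowP => j; rewrite !mxE; ring.
have nd w : dot w w - dot w nu ^+ 2 = dot w (rot2 nu) ^+ 2.
  by rewrite (rotated_norm w); ring.
apply/seteqP; split=> [_ [w /= + <-]|_ [t _ <-]].
  rewrite nd => /E wE; exists (dot w nu * dot w (rot2 nu)) => //.
  by rewrite /= -wE -(rotated_coord w).
exists (t *: nu + rot2 nu).
  rewrite /= nd -[RHS](expr1n R 2) -[X in _ = X ^+ 2]nu2; congr (_ ^+ 2).
  by rewrite dot2E !mxE /=; ring.
by have := E t 1 (expr1n _ _); rewrite scale1r mulr1 /= => ->.
Qed.

(** The derivative of the unit vector is its quarter turn, so [h] has derivative [2 B] at [nu],
    while its value there is [A]. *)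
Lemma asymptotic_of_form n (F : 'M[R]_(2, n.+1)) (t : R) (h : R ->
  'rV[R]_n.+1) :
  F *m F^T = 1%:M -> unit_vec t = nu ->
  (forall s, h s = q (unit_vec s) (unit_vec s) *m F) ->
  ~~ row_free (col_mx (h t) (derive1 h t)) <-> wedge A B = 0.
Proof.
move=> FF tnu hE.
have [ct st] := unit_vecE t; rewrite tnu in ct st.
have hE' : h = (fun s =>
  cos s ^+ 2 *: (L *m F) + (2 * (cos s * sin s)) *: (M *m F)
    + sin s ^+ 2 *: (N *m F)).
  apply/funext => s; rewrite hE /symform; have [-> ->] := unit_vecE s.
  by apply/rowP => j; rewrite !mulmxDl -!scalemxAl !mxE; ring.
have -> : derive1 h t = (2 *: B) *m F.
  rewrite {1}hE' derive1_trig_form -ct -st !scalemxAl -!mulmxDl; congr (_ *m F).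
  by rewrite /symform rot0 rot1; apply/rowP => j; rewrite !mxE; ring.
rewrite hE tnu row_free_wedge // negbK.
have -> : wedge A (2 *: B) = 2 * wedge A B.
  by move: (A) (B) => a b; rewrite /wedge !mxE; ring.
by rewrite mulf_eq0 pnatr_eq0 /=; split=> [/eqP|/eqP].
Qed.

End RotatedForm.

(** * From the definitions of the two curves to the second form *)

(** Summing the components along the rows of [F] is multiplication by [F^T *m F], the normal
    projection when [F] is an orthonormal normal frame. *)
Lemma curvature_sum (R : realType) (L M N : 'rV[R]_4) (F : 'M[R]_(2, 4))
    (w : 'rV[R]_2) :
  \sum_(i < 2) (dot L (row i F) * w 0 0 ^+ 2 +
    2 * dot M (row i F) * w 0 0 * w 0 1
     + dot N (row i F) * w 0 1 ^+ 2) *: row i F =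
  symform L M N w w *m F^T *m F.
Proof.
have dotF x i : dot x (row i F) = (x *m F^T) 0 i.
  by rewrite dotE mxE; apply: eq_bigr => j _; rewrite !mxE.
rewrite -symform_mulmx mulmx_sum_row; apply: eq_bigr => i _; congr (_ *: _).
by rewrite !dotF !mxE; ring.
Qed.

Lemma symform_linear_change (R : realType) n (a b c : 'rV[R]_n) (K : 'M[R]_2) w
  w' :
  let h := symform a b c in
  h (w *m K) (w' *m K) =
  symform (h (row 0 K) (row 0 K)) (h (row 0 K) (row 1 K)) (h (row 1 K) (row 1
    K)) w w'.
Proof.
move=> h; have KE u j : (u *m K) 0 j = u 0 0 * K 0 j + u 0 1 * K 1 j.
  rewrite mxE big_ord_recl big_ord1.
  by rewrite (_ : lift ord0 ord0 = 1 :> 'I_2) //; apply/val_inj.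
by apply/rowP => j; rewrite /h /symform !KE !mxE; ring.
Qed.

Lemma curvature_map_hess (R : realType) (U : set 'rV[R]_2)
    (X : 'rV[R]_2 -> 'rV[R]_4) u (E F : 'M[R]_(2, 4)) w :
  open U -> U u -> smooth_on U X ->
  let K := E *m pinvmx ('J X u) in
  curvature_map X u E F w = hess X u (w *m K) (w *m K) *m F^T *m F.
Proof.
move=> openU Uu smoothX K.
have e i j := partial2_affine openU Uu smoothX K i j.
have -> : hess X u (w *m K) (w *m K) = symform (hess X u (row 0 K) (row 0 K))
    (hess X u (row 0 K) (row 1 K)) (hess X u (row 1 K) (row 1 K)) w w.
  exact: symform_linear_change.
apply: etrans (curvature_sum _ _ _ F w) _.
have eqf := eq_symform w w (e 0 0) (e 0 1) (e 1 1).
exact: (congr1 (fun z => z *m F^T *m F) eqf).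
Qed.

Theorem theorem1p1 (R : realType) (U : set 'rV[R]_2)
    (X : 'rV[R]_2 -> 'rV[R]_4) (u0 : 'rV[R]_2) (v : 'rV[R]_4)
    (E F : 'M[R]_(2, 4)) (B : 'M[R]_(3, 4))
    (openU : open U) (Uu0 : U u0)
    (regX : regular_parametrisation U X)
    (tangent_v : (v <= 'J X u0)%MS) (unit_v : dot v v = 1)
    (* e_1, e_2 and e_3, e_4 *)
    (basisE : orthonormal_basis_of E ('J X u0))
    (basisF : orthonormal_basis_of F (normal_mx X u0))
    (* coordinates on the hyperplane orthogonal to v *)
    (basisB : orthonormal_basis_of B (orth v)) :
  let g := fun u => proj_along v (X u) *m B^T in
  let De := curvature_ellipse X u0 E F in
  let Dp := curvature_parabola g u0 in
  let Pe := normal_plane X u0 in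
  let Pp := normal_plane g u0 in
  let asym := asymptotic X u0 E F v in
  [/\ (* (i) *)
      (is_ellipse De /\ inside_ellipse Pe De 0) <->
      (is_parabola Dp /\ inside_parabola Pp Dp 0),
      (* (ii) *)
      let lhs := (is_ellipse De /\ outside_ellipse Pe De 0) \/
                 (is_segment De /\ line_avoids De 0) in
      let parab := is_parabola Dp /\ outside_parabola Pp Dp 0 in
      let halfl := is_halfline Dp /\ line_avoids Dp 0 in
      [/\ lhs <-> parab \/ halfl,
          lhs -> (parab <-> ~ asym) & lhs -> (halfl <-> asym)],
      (* (iii) *)
      let lhs := is_ellipse De /\ De 0 in
      let parab := is_parabola Dp /\ Dp 0 in
      let line := is_line Dp /\ ~ Dp 0 in
      [/\ lhs <-> parab \/ line,
          lhs -> (parab <-> ~ asym) & lhs -> (line <-> asym)],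
      (* (iv) *)
      ((is_segment De /\ line_contains De 0) \/
       (exists2 z, z != 0 & De = [set z])) <->
      [\/ is_line Dp /\ Dp 0,
          is_halfline Dp /\ line_contains Dp 0 |
          exists2 z, z != 0 & Dp = [set z]] &
      (* (v) *)
      De = [set 0] <-> Dp = [set 0]].
Proof.
case: regX => smoothX /(_ u0 (mem_set Uu0)) freeJ _.
have dX : differentiable X u0 := smoothX [::] u0 (mem_set Uu0).
move=> g De Dp Pe Pp asym.
have gE : g = (fun u => X u *m B^T).
  by apply/funext => u; exact: (proj_along_frame basisB).
have [FF EE] : F *m F^T = 1%:M /\ E *m E^T = 1%:M.
  by case: basisF; case: basisE.
pose J := 'J X u0; pose K := E *m pinvmx J; pose G := F *m B^T.
have JgE : 'J g u0 = J *m B^T by rewrite gE; exact: jacobian_mulmx.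
have GG : G *m G^T = 1%:M := projected_frame tangent_v unit_v basisE basisF
  basisB.
pose nu := v *m E^T.
have nu1 : dot nu nu = 1 := tangent_direction tangent_v unit_v basisE.
pose H := hess X u0.
(* The coefficients [l_i], [m_i], [n_i] of the definition, gathered into one plane vector for each
   letter. *)
pose L := H (row 0 K) (row 0 K) *m F^T.
pose M := H (row 0 K) (row 1 K) *m F^T.
pose N := H (row 1 K) (row 1 K) *m F^T.
have HK w : H (w *m K) (w *m K) *m F^T = symform L M N w w.
  by rewrite symform_mulmx /L /M /N /H; congr (_ *m F^T);
    exact: symform_linear_change.
have etaE t : eta_curve X u0 E F t =
  symform L M N (unit_vec t) (unit_vec t) *m F.
  by rewrite -HK; exact: (curvature_map_hess E F (unit_vec t) openU Uu0
    smoothX).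
have DeE := ellipse_of_form L M N nu1 F.
have DpE := parabola_of_form L M N nu1 G.
have asymE : asym <-> wedge (symform L M N nu nu) (symform L M N nu (rot2 nu))
  = 0.
  have nuE t : v = unit_vec t *m E -> unit_vec t = nu.
    by move=> vt; rewrite /nu vt -mulmxA EE mulmx1.
  split=> [[t /nuE tnu]|].
    by rewrite (asymptotic_of_form FF tnu etaE).
  (* The definition of [asymptotic] asks for an angle representing [v]; the unit vector [nu]
     provides one. *)
  have [|t [ct st]] := @circle_angle R (nu 0 0) (nu 0 1).
    by rewrite -nu1 dot2E !expr2.
  have tnu : unit_vec t = nu.
    by have [u0' u1'] := unit_vecE t; apply/rV2P; rewrite ?u0' ?u1'.
  move=> /(asymptotic_of_form FF tnu etaE); exists t => //.
  by rewrite tnu (tangent_vectorE tangent_v basisE).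
have -> : De = emb_ellipse F
    (2^-1 *: (symform L M N nu nu + symform L M N (rot2 nu) (rot2 nu)))
    (2^-1 *: (symform L M N nu nu - symform L M N (rot2 nu) (rot2 nu)))
    (symform L M N nu (rot2 nu)).
  by rewrite -DeE /De /curvature_ellipse; congr (_ @` _); apply/funext.
have sfE Y : second_form g u0 Y Y = H Y Y *m F^T *m G.
  rewrite second_formE gE (hess_mulmx _ _ _ openU Uu0 smoothX) -gE.
  rewrite /perp /normal_mx JgE.
  exact: (projected_normal tangent_v unit_v basisE basisF basisB).
have ffE w : first_form g u0 (w *m K) (w *m K) = dot w w - dot w nu ^+ 2.
  rewrite /first_form JgE.
  exact: (projected_norm unit_v basisE basisB).
have -> : Dp = emb_parabola G (symform L M N (rot2 nu) (rot2 nu))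
    (2 *: symform L M N nu (rot2 nu)) (symform L M N nu nu).
  (* The substitution [Y = w *m K] passes from the given parameters to coordinates in the tangent
     frame [E]. *)
  rewrite -DpE; apply/seteqP; split=> [_ [Y /= + <-]|_ [w /= + <-]].
    rewrite -(tangent_coord freeJ basisE Y) -/K ffE => Y1.
    by exists (Y *m J *m E^T); rewrite //= -HK sfE.
  by rewrite -ffE => w1; exists (w *m K); rewrite //= sfE HK.
have -> : Pe = rowspan F := normal_rowspan basisF.
have -> : Pp = rowspan G.
  rewrite /Pp /normal_plane /normal_mx JgE.
  exact: (projected_normal_rowspan tangent_v unit_v basisE basisF basisB).
exact: classification.
Qed.
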